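(* Let $n\ge1$, let $PU_n$ be the projective unitary group of an $n$-dimensional complex vector space, and let $P$ be a $PU_n$-principal bundle on a manifold $M$. Then Neeb's class $[\omega_{\rm top\,alg}]\in H^3_{\rm dR}(M)\otimes\mathfrak z$ associated to the problem of lifting $P$ to a $U_n$-bundle, i.e. to $P$ and the central extension $1\to U_1\to U_n\to PU_n\to1$ (with $\mathfrak z={\rm Lie}(U_1)$), is always zero.
   Context: Standing assumptions: $M$ is a finite dimensional, connected, second countable smooth manifold with finite dimensional de Rham cohomology. Neeb's class. Let $P$ be a $K$-principal bundle on $M$ and $1\to Z\to\hat K\to K\to1$ a central extension, with Lie algebras $\mathfrak z,\hat{\mathfrak k},\mathfrak k$ (here $K=PU_n$, $\hat K=U_n$, $Z=U_1$). Put ${\rm Ad}(P)=(P\times\mathfrak k)/K$; the adjoint action of $\hat K$ on $\hat{\mathfrak k}$ factors through $K$, and $\widehat{\rm Ad}(P)=(P\times\hat{\mathfrak k})/K$. Put $\mathcal V(M)=\Gamma(TM)$, $\mathfrak{aut}(P)=\Gamma(TP/K)=\mathcal V(P)^K$ ($K$-invariant vector fields on $P$), $\mathfrak n=\Gamma({\rm Ad}(P))$ (identified with the vertical $K$-invariant vector fields, $f:P\to\mathfrak k$ equivariant corresponding to the vertical field on which a connection form takes the value $-f$), $\hat{\mathfrak n}=\Gamma(\widehat{\rm Ad}(P))$ (the $K$-equivariant smooth maps $P\to\hat{\mathfrak k}$), $\mathfrak c=C^\infty(M,\mathfrak z)$. The projection $\hat{\mathfrak n}\to\mathfrak n$ followed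 by the inclusion $\mathfrak n\subset\mathfrak{aut}(P)$ is a crossed module of topological Lie algebras $\mu:\hat{\mathfrak n}\to\mathfrak{aut}(P)$ with kernel $\mathfrak c$ and cokernel $\mathcal V(M)$, where $\mathfrak{aut}(P)$ acts on $\hat{\mathfrak n}$ by $\eta$, the derivation of functions on $P$ along invariant vector fields. Choose a principal connection $\theta\in\Omega^1(P,\mathfrak k)^K$, with horizontal lift $\sigma:\mathcal V(M)\to\mathfrak{aut}(P)$, and put $S=\eta\circ\sigma$. View the curvature $R_\theta=d\theta+\frac12[\theta,\theta]$ as an ${\rm Ad}(P)$-valued $2$-form on $M$ and lift it to an $\widehat{\rm Ad}(P)$-valued $2$-form $\Omega$ on $M$. Then $\omega_{\rm top\,alg}=d_S\Omega$, where $$d_S\Omega(x_1,x_2,x_3)=\sum_{\rm cycl.}\big(S(x_1)\cdot\Omega(x_2,x_3)-\Omega([x_1,x_2],x_3)\big),\qquad x_i\in\mathcal V(M);$$ it takes values in $\mathfrak c$ and is a closed element of $\Omega^3(M,\mathfrak z)$, whose class in $H^3_{\rm dR}(M)\otimes\mathfrak z$ is $[\omega_{\rm top\,alg}]$. *)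

(* Defs.v *)
From HB Require Import structures.
From mathcomp Require Import all_boot all_order all_algebra.
From mathcomp Require Import ring_quotient spectral sesquilinear complex.
From mathcomp Require Import all_classical all_reals all_analysis.
From mathcomp Require Import ring.

Set Implicit Arguments.
Unset Strict Implicit.
Unset Printing Implicit Defensive.

Import Order.TTheory GRing.Theory Num.Theory.
Import numFieldNormedType.Exports.

Local Open Scope classical_set_scope.
Local Open Scope ring_scope.
Local Open Scope complex_scope.
Local Open Scope sesquilinear_scope.
Local Open Scope quotient_scope.

(** * Smooth spaces and manifolds

  A smooth structure on a topological space is given by its sheaf of smooth
  real functions. Germs are represented by total functions: [smooth_at f x]
  means that [f] is smooth on some neighbourhood of [x], the values of [f]
  elsewhere being irrelevant. *)

Section SmoothSpaces.
Context {R : realType}.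

Fixpoint Ck_on (k m : nat) (U : set 'rV[R]_m) (f : 'rV[R]_m -> R) : Prop :=
  (forall x, U x -> {for x, continuous f}) /\
  if k is k'.+1 then
    forall i : 'I_m,
      (forall x, U x -> derivable f x (delta_mx 0 i)) /\
      Ck_on k' U (fun x => 'D_(delta_mx 0 i) f x)
  else True.

Definition cinf_at (m : nat) (f : 'rV[R]_m -> R) (x : 'rV[R]_m) : Prop :=
  exists2 U, open_nbhs x U & forall k, Ck_on k U f.

End SmoothSpaces.

Record smooth_space (R : realType) := SmoothSpace {
  space_sort :> topologicalType;
  smooth_at : (space_sort -> R) -> space_sort -> Prop }.

Section Manifolds.
Context {R : realType}.
Implicit Types X Y : smooth_space R.

Definition smooth X (f : X -> R) : Prop := forall x, smooth_at f x.

Definition smooth_map_at X Y (h : X -> Y) (x : X) : Prop :=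
  {for x, continuous h} /\
  forall g : Y -> R, smooth_at g (h x) -> smooth_at (g \o h) x.

Definition smooth_map X Y (h : X -> Y) : Prop := forall x, smooth_map_at h x.

(* [phi] is a chart on the open set [U], with image [V] and inverse [psi]. *)
Definition is_chart (m : nat) X (U : set X) (V : set 'rV[R]_m)
    (phi : X -> 'rV[R]_m) (psi : 'rV[R]_m -> X) : Prop :=
  [/\ open U /\ open V,
      forall y, U y -> V (phi y) /\ psi (phi y) = y,
      forall v, V v -> U (psi v) /\ phi (psi v) = v,
      (forall y, U y -> {for y, continuous phi}) /\
      (forall v, V v -> {for v, continuous psi})
    & forall (f : X -> R) y, U y ->
        (smooth_at f y <-> cinf_at (f \o psi) (phi y))].

Definition is_manifold (m : nat) X : Prop :=
  [/\ hausdorff_space X, @second_countable X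
    & forall x : X, exists (U : set X) (V : set 'rV[R]_m) phi psi,
        U x /\ is_chart U V phi psi].

(* Near a point, the smooth functions on a product are the smooth functions of
   finitely many smooth functions of either variable. When the factors are
   manifolds, this is the smooth structure of the product manifold. *)
Definition prod_smooth_at X Y (f : X * Y -> R) (z : X * Y) : Prop :=
  exists (a b : nat) (g : 'I_a -> X -> R) (h : 'I_b -> Y -> R)
         (F : 'rV[R]_(a + b) -> R),
    let gh (w : X * Y) := row_mx (\row_i g i w.1) (\row_j h j w.2) in
    [/\ forall i, smooth_at (g i) z.1, forall j, smooth_at (h j) z.2,
        cinf_at F (gh z) & \forall w \near z, f w = F (gh w)].

Definition prod_space X Y : smooth_space R :=
  @SmoothSpace R (X * Y)%type (@prod_smooth_at X Y).

Definition smooth_vec X (V : lmodType R) (f : X -> V) : Prop :=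
  forall l : {linear V -> R^o}, smooth (l \o f : X -> R).

End Manifolds.

(** * Vector fields and differential forms *)

Section VectorFields.
Context {R : realType}.
Implicit Types M P : smooth_space R.

(* Tangent vectors are derivations of germs of smooth functions; the value on
   functions that are not smooth at [p] is normalized to 0. *)
Definition tangent M (p : M) (v : (M -> R) -> R) : Prop :=
  [/\ forall f g, smooth_at f p -> smooth_at g p ->
        (\forall q \near p, f q = g q) -> v f = v g,
      forall (a : R) f g, smooth_at f p -> smooth_at g p ->
        v (fun q => a * f q + g q) = a * v f + v g,
      forall f g, smooth_at f p -> smooth_at g p ->
        v (fun q => f q * g q) = v f * g p + f p * v g
    & forall f, ~ smooth_at f p -> v f = 0].

Definition vect M : Type := M -> (M -> R) -> R.

Definition vfield M (X : vect M) : Prop :=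
  (forall p, tangent p (X p)) /\
  (forall f p, smooth_at f p -> smooth_at (fun q => X q f) p).

Definition vzero M : vect M := fun _ _ => 0.

Definition vcomb M (f : M -> R) (X Y : vect M) : vect M :=
  fun p g => f p * X p g + Y p g.

Definition bracket M (X Y : vect M) : vect M := fun p f =>
  if `[< smooth_at f p >] then
    X p (fun q => Y q f) - Y p (fun q => X q f)
  else 0.

(* [X] and [Y] are related by the map [h]. *)
Definition related P M (h : P -> M) (X : vect P) (Y : vect M) : Prop :=
  forall p f, smooth_at f (h p) -> X p (f \o h) = Y (h p) f.

(* Derivative of a function with values in a finite-dimensional space: the
   vector all of whose coordinates are the derivatives of the coordinates. *)
Definition vder M (V : lmodType R) (X : vect M) (f : M -> V) : M -> V :=
  fun p => xget 0 [set v | forall l : {linear V -> R^o}, l v = X p (l \o f)].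

Definition vfields M (k : nat) (s : seq (vect M)) : Prop :=
  size s = k /\ forall i, (i < k)%N -> vfield (nth (@vzero M) s i).

(* Alternating [C^oo(M)]-multilinear maps from [k]-tuples of vector fields on
   [M] to a module [N] of [V]-valued functions on [E], on which [C^oo(M)] acts
   through [pr : E -> M]. With [E = M] these are the [V]-valued [k]-forms on [M];
   with [E] a principal bundle and [N] the equivariant functions, the [k]-forms
   with values in the associated vector bundle. *)
Definition altform M (E : Type) (pr : E -> M) (V : lmodType R)
    (N : set (E -> V)) (k : nat) (w : seq (vect M) -> E -> V) : Prop :=
  [/\ forall s, vfields k s -> N (w s),
      forall s t X Y (f : M -> R), smooth f ->
        vfields k (s ++ X :: t) -> vfields k (s ++ Y :: t) ->
        w (s ++ vcomb f X Y :: t) =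
        (fun e => f (pr e) *: w (s ++ X :: t) e + w (s ++ Y :: t) e)
    & forall s t u X, vfields k (s ++ X :: t ++ X :: u) ->
        w (s ++ X :: t ++ X :: u) = (fun=> 0)].

Definition form M (V : lmodType R) (k : nat) (w : seq (vect M) -> M -> V) :=
  altform id [set f | smooth_vec f] k w.

Definition del T (i : nat) (s : seq T) : seq T := take i s ++ drop i.+1 s.

(* Exterior derivative (the formula without a factor 1 / (k + 1)). *)
Definition extd M (V : lmodType R) (w : seq (vect M) -> M -> V) :
    seq (vect M) -> M -> V := fun s p =>
  let X i := nth (@vzero M) s i in
  \sum_(i < size s) (-1) ^+ i *: vder (X i) (w (del i s)) p +
  \sum_(i < size s) \sum_(j < size s | (i < j)%N)
    (-1) ^+ (i + j) *: w (bracket (X i) (X j) :: del i (del j s)) p.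

Definition closed_form M (V : lmodType R) (k : nat)
    (w : seq (vect M) -> M -> V) : Prop :=
  form k w /\ forall s, vfields k.+1 s -> extd w s = (fun=> 0).

Definition exact_form M (V : lmodType R) (k : nat)
    (w : seq (vect M) -> M -> V) : Prop :=
  if k is j.+1 then
    exists2 b, form j b & forall s, vfields k s -> w s = extd b s
  else forall s, vfields k s -> w s = (fun=> 0).

Definition finite_dim_deRham M : Prop :=
  forall k, exists (N : nat) (b : 'I_N -> seq (vect M) -> M -> R^o),
    (forall i, closed_form k (b i)) /\
    forall w : seq (vect M) -> M -> R^o, closed_form k w ->
      exists c : 'I_N -> R,
        exact_form k (fun s p => w s p - \sum_(i < N) c i *: b i s p).

End VectorFields.

(** * The unitary group and its Lie algebra *)

Section Unitary.
Context {R : realType}.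
Local Notation C := R[i].

Section Ugroup.
Variable n : nat.

Record Ugrp := MkU { Umx :> 'M[C]_n; _ : Umx \is unitarymx }.
HB.instance Definition _ := [isSub for Umx].
HB.instance Definition _ := [Choice of Ugrp by <:].

Lemma Uunitary (u : Ugrp) : Umx u \is unitarymx. Proof. exact: valP. Qed.

Fact U1_subproof : (1%:M : 'M[C]_n) \is unitarymx.
Proof. by apply/unitarymxP; rewrite trmx1 map_mx1 mulmx1. Qed.

Fact Uinv_subproof (u : Ugrp) : ((Umx u)^t* : 'M[C]_n) \is unitarymx.
Proof. by rewrite trmxC_unitary Uunitary. Qed.

Definition Uone : Ugrp := MkU U1_subproof.
Definition Umul (u v : Ugrp) : Ugrp := MkU (mul_unitarymx (Uunitary u) (Uunitary v)).
Definition Uinv (u : Ugrp) : Ugrp := MkU (Uinv_subproof u).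

Fact UmulA : associative Umul.
Proof. by move=> u v w; apply: val_inj; rewrite /= mulmxA. Qed.
Fact Umul1 : left_id Uone Umul.
Proof. by move=> u; apply: val_inj; rewrite /= mul1mx. Qed.
Fact Umulr1 : right_id Uone Umul.
Proof. by move=> u; apply: val_inj; rewrite /= mulmx1. Qed.
Fact UmulrV : right_inverse Uone Uinv Umul.
Proof. by move=> u; apply: val_inj; apply/unitarymxP/Uunitary. Qed.
Fact UmulV : left_inverse Uone Uinv Umul.
Proof.
move=> u; apply: val_inj => /=; apply: mulmx1C.
exact/unitarymxP/Uunitary.
Qed.

HB.instance Definition _ := isGroup.Build Ugrp UmulA Umul1 Umulr1 UmulV UmulrV.

Definition real_coord (A : 'M[C]_n) : 'rV[R]_(n * n + n * n) :=
  row_mx (mxvec (map_mx (fun z : C => complex.Re z) A))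
         (mxvec (map_mx (fun z : C => complex.Im z) A)).

HB.instance Definition _ :=
  Topological.copy Ugrp (initial_topology (fun u : Ugrp => real_coord u)).

(* The smooth structure of [Ugrp] as a submanifold of the matrix space. *)
Definition U_smooth_at (f : Ugrp -> R) (u : Ugrp) : Prop :=
  exists2 F : 'rV[R]_(n * n + n * n) -> R,
    cinf_at F (real_coord u) & \forall v \near u, f v = F (real_coord v).

Definition is_skewherm : {pred 'M[C]_n} := fun A => A^t* == - A.

Fact is_skewherm_zmod : zmod_closed is_skewherm.
Proof.
split=> [|A B]; rewrite !unfold_in; first by rewrite trmx0 map_mx0 oppr0.
by move=> /eqP hA /eqP hB; rewrite linearB /= map_mxB hA hB opprB opprK addrC.
Qed.
HB.instance Definition _ :=
  GRing.isZmodClosed.Build _ is_skewherm is_skewherm_zmod.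

Record u_alg := MkUalg { u_mx :> 'M[C]_n; _ : is_skewherm u_mx }.
HB.instance Definition _ := [isSub for u_mx].
HB.instance Definition _ := [Choice of u_alg by <:].
HB.instance Definition _ := [SubChoice_isSubZmodule of u_alg by <:].

Lemma u_skew (A : u_alg) : A^t* = - (A : 'M[C]_n).
Proof. by apply/eqP; exact: (valP A). Qed.

Fact u_scale_subproof (a : R) (A : u_alg) : is_skewherm (a%:C *: (A : 'M[C]_n)).
Proof.
apply/eqP; rewrite linearZ /= map_mxZ u_skew /= scalerN; congr (- (_ *: _)).
by apply/eqP; rewrite eq_complex /= oppr0 !eqxx.
Qed.
Definition u_scale a A := MkUalg (u_scale_subproof a A).

Fact u_scaleA a b A : u_scale a (u_scale b A) = u_scale (a * b) A.
Proof. by apply: val_inj; rewrite /= scalerA rmorphM. Qed.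
Fact u_scale1 : left_id 1 u_scale.
Proof. by move=> A; apply: val_inj; rewrite /= rmorph1 scale1r. Qed.
Fact u_scaleDr : right_distributive u_scale +%R.
Proof. by move=> a A B; apply: val_inj; rewrite /= scalerDr. Qed.
Fact u_scaleDl A : {morph u_scale^~ A : a b / a + b}.
Proof. by move=> a b; apply: val_inj; rewrite /= rmorphD scalerDl. Qed.
HB.instance Definition _ := GRing.Zmodule_isLmodule.Build R u_alg
  u_scaleA u_scale1 u_scaleDr u_scaleDl.

Fact u_bracket_subproof (A B : u_alg) :
  is_skewherm ((A : 'M[C]_n) *m B - (B : 'M[C]_n) *m A).
Proof.
apply/eqP; rewrite linearB /= map_mxB !trmx_mul !map_mxM /= !u_skew.
by rewrite !mulNmx !mulmxN !opprK opprB.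
Qed.
Definition u_bracket (A B : u_alg) : u_alg := MkUalg (u_bracket_subproof A B).

Fact Ad_subproof (u : Ugrp) (A : u_alg) :
  is_skewherm (Umx u *m A *m (Umx u)^t*).
Proof.
apply/eqP; rewrite !trmx_mul !map_mxM /= u_skew.
by rewrite trmxCK mulmxA mulmxN mulNmx.
Qed.
Definition Ad (u : Ugrp) (A : u_alg) : u_alg := MkUalg (Ad_subproof u A).

(* [c] is the one-parameter subgroup t |-> exp (t A). *)
Definition one_param (A : u_alg) (c : R -> Ugrp) : Prop :=
  (forall s t, c (s + t) = (c s * c t)%g) /\
  forall i j,
    is_derive (0 : R) (1 : R) (fun t => complex.Re (c t i j)) (complex.Re (A i j)) /\
    is_derive (0 : R) (1 : R) (fun t => complex.Im (c t i j)) (complex.Im (A i j)).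

End Ugroup.

Section Quotients.
Variable n : nat.

(* The inclusion of U_1 in U_n as scalar matrices, and its derivative. *)
Fact Uscalar_subproof (z : Ugrp 1) : ((Umx z 0 0)%:M : 'M[C]_n) \is unitarymx.
Proof.
apply/unitarymxP; rewrite tr_scalar_mx map_scalar_mx -scalar_mxM; congr _%:M.
have /unitarymxP/matrixP/(_ 0 0) := Uunitary z.
by rewrite !mxE big_ord1 !mxE eqxx.
Qed.
Definition Uscalar (z : Ugrp 1) : Ugrp n := MkU (Uscalar_subproof z).

Fact u_scalar_subproof (z : u_alg 1) : is_skewherm ((u_mx z 0 0)%:M : 'M[C]_n).
Proof.
apply/eqP; rewrite tr_scalar_mx map_scalar_mx -raddfN; congr _%:M.
by have /matrixP/(_ 0 0) := u_skew z; rewrite !mxE.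
Qed.
Definition u_scalar (z : u_alg 1) : u_alg n := MkUalg (u_scalar_subproof z).

Fact UscalarM z w : Uscalar (z * w)%g = (Uscalar z * Uscalar w)%g.
Proof. by apply: val_inj; rewrite /= -scalar_mxM mxE big_ord1. Qed.

Fact UscalarC z (u : Ugrp n) : (Uscalar z * u)%g = (u * Uscalar z)%g.
Proof. by apply: val_inj; rewrite /= scalar_mxC. Qed.

Fact Uscalar1 : Uscalar 1%g = 1%g.
Proof. by apply: val_inj; rewrite /= mxE eqxx. Qed.

(* PU_n = U_n / U_1 *)
Definition PU_rel (u v : Ugrp n) : bool :=
  `[< exists z : Ugrp 1, u = (Uscalar z * v)%g >].

Fact PU_rel_equiv : equiv_class_of PU_rel.
Proof.
have sym u v : PU_rel u v -> PU_rel v u.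
  move=> /asboolP[z ->]; apply/asboolP; exists z^-1%g.
  by rewrite mulgA -UscalarM mulVg Uscalar1 mul1g.
split=> [u|u v|v u w].
- by apply/asboolP; exists 1%g; rewrite Uscalar1 mul1g.
- by apply/idP/idP; exact: sym.
move=> /asboolP[z ->] /asboolP[z' ->]; apply/asboolP; exists (z * z')%g.
by rewrite UscalarM mulgA.
Qed.
Canonical PU_rel_canonical := EquivRelPack PU_rel_equiv.

Definition PU_quot := {eq_quot PU_rel}.
HB.instance Definition _ := Quotient.on PU_quot.
HB.instance Definition _ := Choice.on PU_quot.
Definition PU := quotient_topology PU_quot.
HB.instance Definition _ := Quotient.on PU.
HB.instance Definition _ := Topological.on PU.

Definition toPU (u : Ugrp n) : PU := \pi_PU u.

Lemma toPU_eqP (u v : Ugrp n) :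
  toPU u = toPU v <-> exists z : Ugrp 1, u = (Uscalar z * v)%g.
Proof.
split=> [h|h].
  by apply/asboolP; apply/(eqquotP PU_quot); exact: h.
by apply/(eqquotP PU_quot)/asboolP.
Qed.

Lemma toPU_repr (k : PU) : toPU (repr k) = k. Proof. exact: reprK. Qed.

Definition PUone : PU := toPU 1%g.
Definition PUmul (k l : PU) : PU := toPU (repr k * repr l)%g.
Definition PUinv (k : PU) : PU := toPU (repr k)^-1%g.

Lemma repr_toPU (u : Ugrp n) : exists z : Ugrp 1, repr (toPU u) = (Uscalar z * u)%g.
Proof. by apply/toPU_eqP; rewrite toPU_repr. Qed.

Lemma toPUM (u v : Ugrp n) : toPU (u * v)%g = PUmul (toPU u) (toPU v).
Proof.
have [z hz] := repr_toPU u; have [w hw] := repr_toPU v.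
apply/esym/toPU_eqP; exists (z * w)%g; rewrite hz hw UscalarM.
by rewrite -!mulgA; congr (_ * _)%g; rewrite !mulgA UscalarC.
Qed.

Lemma toPUV (u : Ugrp n) : toPU u^-1%g = PUinv (toPU u).
Proof.
have [z hz] := repr_toPU u.
apply/esym/toPU_eqP; exists z^-1%g; rewrite hz invgM UscalarC.
congr (_ * _)%g; apply: (mulgI (Uscalar z)).
by rewrite mulgV -UscalarM mulgV Uscalar1.
Qed.

Fact PUmulA : associative PUmul.
Proof.
move=> k l h; rewrite -(toPU_repr k) -(toPU_repr l) -(toPU_repr h).
by rewrite -!toPUM mulgA.
Qed.
Fact PUmul1 : left_id PUone PUmul.
Proof. by move=> k; rewrite -(toPU_repr k) -toPUM mul1g. Qed.
Fact PUmulr1 : right_id PUone PUmul.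
Proof. by move=> k; rewrite -(toPU_repr k) -toPUM mulg1. Qed.
Fact PUmulV : left_inverse PUone PUinv PUmul.
Proof. by move=> k; rewrite -(toPU_repr k) -toPUV -toPUM mulVg. Qed.
Fact PUmulrV : right_inverse PUone PUinv PUmul.
Proof. by move=> k; rewrite -(toPU_repr k) -toPUV -toPUM mulgV. Qed.

HB.instance Definition _ := isGroup.Build PU PUmulA PUmul1 PUmulr1 PUmulV PUmulrV.

(* The smooth structure of the quotient Lie group: U_n -> PU_n is a
   submersion. *)
Definition PU_space : smooth_space R :=
  @SmoothSpace R PU (fun f k => forall u, toPU u = k -> U_smooth_at (f \o toPU) u).

(* pu_n = u_n / u_1, the Lie algebra of PU_n *)
Definition u_center : {pred u_alg n} := fun A => `[< exists z, A = u_scalar z >].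

Fact u_center_zmod : zmod_closed u_center.
Proof.
split=> [|A B]; rewrite !unfold_in.
  by apply/asboolP; exists 0; apply: val_inj; rewrite /= mxE raddf0.
move=> /asboolP[z ->] /asboolP[w ->]; apply/asboolP; exists (z - w).
by apply: val_inj; rewrite /= !mxE raddfB.
Qed.
HB.instance Definition _ := GRing.isZmodClosed.Build _ u_center u_center_zmod.

Definition pu_alg := Quotient.quot u_center.
HB.instance Definition _ := GRing.Zmodule.on pu_alg.

Definition to_pu (A : u_alg n) : pu_alg := \pi_(Quotient.quot u_center) A.

Lemma to_pu_eqP (A B : u_alg n) :
  to_pu A = to_pu B <-> exists z, A - B = u_scalar z.
Proof.
split=> [/eqP|h]; first by rewrite -Quotient.idealrBE => /asboolP.
by apply/eqP; rewrite -Quotient.idealrBE; apply/asboolP.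
Qed.

Lemma to_pu_repr (a : pu_alg) : to_pu (repr a) = a. Proof. exact: reprK. Qed.

Lemma to_puB : {morph to_pu : A B / A - B}.
Proof. by move=> A B; rewrite /to_pu raddfB. Qed.
Lemma to_puD : {morph to_pu : A B / A + B}.
Proof. by move=> A B; rewrite /to_pu raddfD. Qed.

Definition pu_scale (a : R) (x : pu_alg) : pu_alg := to_pu (a *: repr x).

Lemma to_puZ a A : to_pu (a *: A) = pu_scale a (to_pu A).
Proof.
apply/to_pu_eqP; have [z hz] := (to_pu_eqP A (repr (to_pu A))).1
  (esym (to_pu_repr _)).
exists (a *: z); rewrite -scalerBr hz; apply: val_inj.
by rewrite /= mxE -scale_scalar_mx.
Qed.

Fact pu_scaleA a b x : pu_scale a (pu_scale b x) = pu_scale (a * b) x.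
Proof. by rewrite -(to_pu_repr x) -!to_puZ scalerA. Qed.
Fact pu_scale1 : left_id 1 pu_scale.
Proof. by move=> x; rewrite -(to_pu_repr x) -to_puZ scale1r. Qed.
Fact pu_scaleDr : right_distributive pu_scale +%R.
Proof.
move=> a x y; rewrite -(to_pu_repr x) -(to_pu_repr y).
by rewrite -to_puD -!to_puZ -to_puD scalerDr.
Qed.
Fact pu_scaleDl x : {morph pu_scale^~ x : a b / a + b}.
Proof.
by move=> a b; rewrite -(to_pu_repr x) -!to_puZ -to_puD scalerDl.
Qed.
HB.instance Definition _ := GRing.Zmodule_isLmodule.Build R pu_alg
  pu_scaleA pu_scale1 pu_scaleDr pu_scaleDl.

Definition pu_bracket (x y : pu_alg) : pu_alg := to_pu (u_bracket (repr x) (repr y)).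

(* The adjoint action of PU_n on u_n and on pu_n. *)
Definition PU_Ad (k : PU) (A : u_alg n) : u_alg n := Ad (repr k) A.
Definition PU_ad (k : PU) (x : pu_alg) : pu_alg := to_pu (PU_Ad k (repr x)).

(* The definitions by representatives do not depend on their choice. *)
Lemma PU_AdE (u : Ugrp n) A : PU_Ad (toPU u) A = Ad u A.
Proof.
have [z hz] := repr_toPU u; apply: val_inj; rewrite /= hz /=.
rewrite !mul_scalar_mx linearZ /= map_mxZ -!scalemxAl -scalemxAr scalerA.
have /unitarymxP/matrixP/(_ 0 0) := Uunitary z.
by rewrite !mxE big_ord1 !mxE eqxx => ->; rewrite scale1r.
Qed.

Lemma PU_adE (u : Ugrp n) A : PU_ad (toPU u) (to_pu A) = to_pu (Ad u A).
Proof.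
have [z hz] := (to_pu_eqP (repr (to_pu A)) A).1 (to_pu_repr _).
apply/to_pu_eqP; exists z; rewrite PU_AdE; apply: val_inj => /=.
rewrite -mulmxBl -mulmxBr; have /(congr1 val)/= -> := hz.
by have /unitarymxP uu := Uunitary u; rewrite scalar_mxC -mulmxA uu mulmx1.
Qed.

Lemma pu_bracketE A B : pu_bracket (to_pu A) (to_pu B) = to_pu (u_bracket A B).
Proof.
have [z hz] := (to_pu_eqP (repr (to_pu A)) A).1 (to_pu_repr _).
have [w hw] := (to_pu_eqP (repr (to_pu B)) B).1 (to_pu_repr _).
congr to_pu; rewrite -(subrK A (repr _)) hz -(subrK B (repr (to_pu B))) hw.
apply: val_inj; rewrite /= !mulmxDl !mulmxDr !mul_scalar_mx !mul_mx_scalar.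
move: (_ *m u_mx B) (_ *m u_mx A) => AB BA.
by apply/matrixP=> i j; rewrite !mxE; ring.
Qed.

End Quotients.

End Unitary.

Arguments PU R n : clear implicits.
Arguments PU_space R n : clear implicits.
Arguments u_alg R n : clear implicits.
Arguments pu_alg R n : clear implicits.

(** * Principal PU_n-bundles, connections and the cocycle of the lifting problem *)

Section Bundles.
Context {R : realType} {n : nat} {M P : smooth_space R}.
Variables (pr : P -> M) (act : P -> PU R n -> P).

(* [p |-> (pr p, tau p)] is an equivariant diffeomorphism from the part of [P]
   above [U] onto [U * PU_n], with inverse [psi]. *)
Definition is_trivialization (U : set M) (tau : P -> PU R n)
    (psi : M * PU R n -> P) : Prop :=
  [/\ forall p, U (pr p) ->
        psi (pr p, tau p) = p /\
        @smooth_map_at R P (prod_space M (PU_space R n))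
          (fun q => (pr q, tau q)) p,
      forall x k, U x ->
        [/\ pr (psi (x, k)) = x, tau (psi (x, k)) = k
          & @smooth_map_at R (prod_space M (PU_space R n)) P psi (x, k)]
    & forall p k, U (pr p) -> tau (act p k) = (tau p * k)%g].

Definition principal_bundle : Prop :=
  [/\ smooth_map pr,
      @smooth_map R (prod_space P (PU_space R n)) P (fun z => act z.1 z.2),
      (forall p, act p 1%g = p) /\
      (forall p k l, act (act p k) l = act p (k * l)%g),
      forall p k, pr (act p k) = pr p
    & forall x, exists (U : set M) tau psi,
        open_nbhs x U /\ is_trivialization U tau psi].

(* The sections of (P * u_n) / PU_n, as equivariant functions on [P]. *)
Definition hatAd_sections : set (P -> u_alg R n) :=
  [set f | smooth_vec f /\ forall p k, f (act p k) = PU_Ad k^-1%g (f p)].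

Definition pushfwd (k : PU R n) (X : vect P) : vect P :=
  fun q f => X (act q k^-1%g) (fun r => f (act r k)).

Definition aut_field (X : vect P) : Prop :=
  vfield X /\ forall k, pushfwd k X = X.

(* [X] is the vector field generated by the class of [A] in pu_n. *)
Definition fundamental (A : u_alg R n) (X : vect P) : Prop :=
  exists2 c : R -> Ugrp n, one_param A c &
    forall p (f : P -> R), smooth_at f p ->
      is_derive (0 : R) (1 : R) (fun t => f (act p (toPU (c t)))) (X p f).

Definition connection (theta : seq (vect P) -> P -> pu_alg R n) : Prop :=
  [/\ form 1 theta,
      forall k X p, vfield X ->
        theta [:: pushfwd k X] (act p k) = PU_ad k^-1%g (theta [:: X] p)
    & forall A X p, vfield X -> fundamental A X -> theta [:: X] p = to_pu A].

Definition horizontal_lift (theta : seq (vect P) -> P -> pu_alg R n)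
    (sigma : vect M -> vect P) : Prop :=
  forall x, vfield x ->
    [/\ aut_field (sigma x), related pr (sigma x) x
      & theta [:: sigma x] = (fun=> 0)].

(* d theta + 1/2 [theta, theta], where
   [theta, theta](X, Y) = [theta X, theta Y] - [theta Y, theta X] *)
Definition curvature (theta : seq (vect P) -> P -> pu_alg R n)
    (X Y : vect P) (p : P) : pu_alg R n :=
  extd theta [:: X; Y] p +
  2^-1 *: (pu_bracket (theta [:: X] p) (theta [:: Y] p) -
           pu_bracket (theta [:: Y] p) (theta [:: X] p)).

(* The Ad(P)-valued 2-form on [M] corresponding to the curvature is the one
   whose value on [x], [y] is that of the curvature on any vector fields [X], [Y]
   on [P] that project to [x], [y]. *)
Definition curvature_lift (theta : seq (vect P) -> P -> pu_alg R n)
    (Omega : seq (vect M) -> P -> u_alg R n) : Prop :=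
  altform pr hatAd_sections 2 Omega /\
  forall x y X Y, vfield x -> vfield y -> vfield X -> vfield Y ->
    related pr X x -> related pr Y y ->
    forall p, to_pu (Omega [:: x; y] p) = curvature theta X Y p.

Definition dS (sigma : vect M -> vect P) (Omega : seq (vect M) -> P -> u_alg R n)
    (x1 x2 x3 : vect M) (p : P) : u_alg R n :=
  let S x (f : P -> u_alg R n) := vder (sigma x) f in
    (S x1 (Omega [:: x2; x3]) p - Omega [:: bracket x1 x2; x3] p)
  + (S x2 (Omega [:: x3; x1]) p - Omega [:: bracket x2 x3; x1] p)
  + (S x3 (Omega [:: x1; x2]) p - Omega [:: bracket x3 x1; x2] p).

(* [omega] is [dS sigma Omega], seen as a closed 3-form on [M] with values in
   u_1, the Lie algebra of U_1. *)
Definition is_omega_topalg (sigma : vect M -> vect P)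
    (Omega : seq (vect M) -> P -> u_alg R n)
    (omega : seq (vect M) -> M -> u_alg R 1) : Prop :=
  closed_form 3 omega /\
  forall x1 x2 x3, vfield x1 -> vfield x2 -> vfield x3 ->
    forall p, u_scalar n (omega [:: x1; x2; x3] (pr p)) =
              dS sigma Omega x1 x2 x3 p.

End Bundles.

(* Main.v *)
From HB Require Import structures.
From mathcomp Require Import all_boot all_order all_algebra.
From mathcomp Require Import sesquilinear complex.
From mathcomp Require Import all_classical all_reals all_analysis.
Require Import Defs.
From mathcomp Require Import ring lra.

(** Since n is positive, the Lie algebra u_n splits, as a representation of
    PU_n, into the traceless matrices and the scalar matrices u_1, and the
    traceless part maps isomorphically onto pu_n.  Hence the lift Omega of the
    curvature is the sum of a traceless part and of a scalar part beta, the
    normalized trace of Omega.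

    The form d_S Omega vanishes in pu_n: there Omega becomes the curvature of
    theta, and the statement is the Bianchi identity ([bianchi]).  So d_S Omega
    is scalar, and it is determined by its normalized trace ([to_pu_eq0]).

    The trace is invariant under the adjoint action and PU_n acts transitively
    on the fibres of P ([fibre_transitive]), so beta lives on M; it is smooth
    there because P has smooth local sections ([smooth_descends]).  The trace is
    linear, hence commutes with the derivative along vector fields
    ([linear_vder]), and the derivative along the lift of x of a function pulled
    back from M is the pullback of its derivative along x ([related_vder]).
    Therefore the normalized trace of d_S Omega is the pullback of d beta.  Thus
    omega = d beta represents the class of the lifting problem, and it is exact.

    That d beta is a closed 3-form ([closed_extd3]) is the usual computation with
    brackets.  What remains is the calculus of the smooth structures: smooth
    functions on a manifold form an algebra stable under smooth operations, the
    point being the chain rule for functions with continuous partial derivatives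
    ([derive_row_comp], [cinf_at_comp]), and the bracket of two vector fields is
    a vector field satisfying the Jacobi identity ([jacobi]). *)

Set Implicit Arguments.
Unset Strict Implicit.
Unset Printing Implicit Defensive.

Import Order.TTheory GRing.Theory Num.Theory.
Import numFieldNormedType.Exports.

Local Open Scope classical_set_scope.
Local Open Scope ring_scope.


(** * Smooth functions on R^m and the chain rule *)

Section Calculus.
Context {R : realType}.

(** By the mean value theorem, the error of an affine approximation is controlled
    by the oscillation of the derivative; this is applied to one coordinate
    segment at a time. *)
Lemma mvt_le (g dg : R -> R) (a b c e : R) : a <= b ->
  (forall s, s \in `[a, b] -> is_derive s (1 : R) g (dg s)) ->
  (forall s, s \in `[a, b] -> `|dg s - c| <= e) ->
  `|g b - g a - (b - a) * c| <= (b - a) * e.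
Proof.
move=> ab gd dge.
have gc : {within `[a, b], continuous g}.
  by apply: derivable_within_continuous => s /gd d; apply: ex_derive.
have gd' s : s \in `]a, b[ -> is_derive s (1 : R) g (dg s).
  by move=> sab; apply: gd; exact: subset_itv_oo_cc sab.
have [s sab ->] := MVT_segment ab gd' gc.
rewrite [(b - a) * c]mulrC -mulrBl normrM mulrC (ger0_norm (_ : 0 <= b - a)) ?subr_ge0//.
by rewrite ler_wpM2l ?subr_ge0// dge.
Qed.

Section Differentiability.
Variable N : nat.
Implicit Types (f : 'rV[R]_N -> R) (x y h p v : 'rV[R]_N).

Definition row_form p h : R := \sum_j h 0 j * p 0 j.

Fact row_form_linear p : linear (row_form p).
Proof.
move=> a u v; rewrite /row_form scaler_sumr -big_split /=; apply: eq_bigr => j _.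
by rewrite !mxE mulrDl -mulrA.
Qed.
HB.instance Definition _ p :=
  GRing.isLinear.Build R 'rV[R]_N R _ (row_form p) (row_form_linear p).

Lemma row_form_continuous p : continuous (row_form p).
Proof.
apply: continuous_big => [|j _ x]; first exact: add_continuous.
by apply: continuousM; [exact: coord_continuous|exact: cst_continuous].
Qed.

Lemma le_coord_norm h j : `|h 0 j| <= `|h|.
Proof. by rewrite [leRHS]/Num.Def.normr/= mx_normrE; exact: (le_bigmax _ _ (0, j)). Qed.

Lemma norm_row_le h (e : R) : 0 <= e -> (forall j, `|h 0 j| <= e) -> `|h| <= e.
Proof.
move=> e0 he; rewrite [leLHS]/Num.Def.normr/= mx_normrE.
by apply: bigmax_le => // -[i j] _; rewrite ord1.
Qed.

Lemma derive_along f x v t :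
  derivable f (x + t *: v) v ->
  is_derive t (1 : R) (fun s => f (x + s *: v)) ('D_v f (x + t *: v)).
Proof.
move=> fd.
have E : (fun h : R => h^-1 *: (((fun s => f (x + s *: v)) \o shift t) (h *: (1 : R))
             - f (x + t *: v))) =
         (fun h : R => h^-1 *: ((f \o shift (x + t *: v)) (h *: v) - f (x + t *: v))).
  apply/funext => h /=; do 2 f_equal; congr f.
  by rewrite scalerDl [h *: 1]mulr1 addrCA addrA.
split; first by rewrite /derivable E.
by rewrite /derive E.
Qed.

Lemma increment_le f x v (c e t : R) :
  (forall s, `|s| <= `|t| -> derivable f (x + s *: v) v /\
      `|'D_v f (x + s *: v) - c| <= e) ->
  `|f (x + t *: v) - f x - t * c| <= `|t| * e.
Proof.
move=> H.
have key a b : a <= b -> (forall s, s \in `[a, b] -> `|s| <= `|t|) ->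
    `|f (x + b *: v) - f (x + a *: v) - (b - a) * c| <= (b - a) * e.
  move=> ab hs.
  have hd s : s \in `[a, b] ->
      is_derive s (1 : R) (fun s => f (x + s *: v)) ('D_v f (x + s *: v)).
    by move=> sab; have [d _] := H _ (hs _ sab); apply: (derive_along d).
  by apply: (mvt_le ab hd) => s sab; have [] := H _ (hs _ sab).
have [t0|t0] := leP 0 t.
  have := key 0 t t0; rewrite scale0r addr0 subr0 ger0_norm//; apply.
  by move=> s; rewrite in_itv/= => /andP[s0 st]; rewrite ger0_norm.
have := key t 0 (ltW t0); rewrite scale0r addr0 sub0r ltr0_norm//.
rewrite -normrN (_ : - (_ - _) = f (x + t *: v) - f x - t * c); last by ring.
apply => s; rewrite in_itv/= => /andP[s0 st]; rewrite ler0_norm//.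
by rewrite lerN2.
Qed.

(** The increment of [f] from [x] to [x + h] is cut into [N] steps, each along a
    coordinate axis. On each step the partial derivative stays close to its
    value at [x] by continuity, so that [mvt_le] bounds the error by a small
    multiple of [h]. *)
Lemma differentiable_partials f x :
  (forall j, \forall y \near x, derivable f y (delta_mx 0 j)) ->
  (forall j, {for x, continuous (fun y => 'D_(delta_mx 0 j) f y)}) ->
  is_diff x f (row_form (\row_j 'D_(delta_mx 0 j) f x)).
Proof.
move=> fd fc; set p := \row_j _.
have E : f \o shift x = cst (f x) + row_form p +o_ (0 : 'rV[R]_N) id.
  apply/eqaddoP => _/posnumP[e].
  have e'0 : 0 < e%:num / N.+1%:R by rewrite divr_gt0.
  set e' := e%:num / _ in e'0.
  have : \forall y \near x, forall j, derivable f y (delta_mx 0 j) /\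
      `|'D_(delta_mx 0 j) f y - p 0 j| <= e'.
    apply: (@filter_forall _ 'I_N (fun j y => derivable f y (delta_mx 0 j) /\
      `|'D_(delta_mx 0 j) f y - p 0 j| <= e') (nbhs x) (nbhs_filter x)) => j.
    apply: filterI; first exact: fd.
    have /cvgrPdist_le/(_ _ e'0) := fc j.
    by apply: filterS => y; rewrite distrC mxE.
  move=> /nbhs_ballP[r /= r0 Hr].
  apply/nbhs_ballP; exists r => //= h.
  rewrite -ball_normE /= sub0r normrN => hr.
  (* the point reached after moving along the first k axes, minus x *)
  pose hk k : 'rV[R]_N := \row_i (if (i < k)%N then h 0 i else 0).
  have hk0 : hk 0%N = 0 by apply/rowP => i; rewrite !mxE.
  have hkN : hk N = h by apply/rowP => i; rewrite !mxE ltn_ord.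
  have hkS (j : 'I_N) : hk j.+1 = hk j + h 0 j *: delta_mx 0 j.
    apply/rowP => i; rewrite !mxE eqxx/= ltnS leq_eqVlt.
    have [->|ne] := eqVneq i j; first by rewrite eqxx /= ltnn add0r mulr1.
    by rewrite (negPf (_ : (i : nat) != j)) //= mulr0 addr0.
  have -> : (f \o shift x - (cst (f x) + row_form p)) h =
      \sum_(j < N) (f (x + hk j.+1) - f (x + hk j) - h 0 j * p 0 j).
    rewrite sumrB -(big_mkord xpredT (fun j => f (x + hk j.+1) - f (x + hk j))).
    rewrite telescope_sumr// hk0 hkN addr0 opprD addrA; congr (_ - _ - _).
    by rewrite /= addrC.
  apply: le_trans (ler_norm_sum _ _ _) _.
  have : \sum_(j < N) `|f (x + hk j.+1) - f (x + hk j) - h 0 j * p 0 j| <=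
      \sum_(j < N) `|h| * e'.
    apply: ler_sum => j _; rewrite hkS addrA.
    apply: le_trans (increment_le (e := e') _) _; last first.
      by rewrite ler_wpM2r ?le_coord_norm// ltW.
    move=> s hs; rewrite -addrA.
    have : ball x r (x + (hk j + s *: delta_mx 0 j)).
      rewrite -ball_normE /= opprD addNKr normrN (le_lt_trans _ hr)//.
      apply: norm_row_le => // i; rewrite !mxE eqxx/=.
      have [->|ne] := eqVneq i j.
        by rewrite ltnn add0r mulr1 (le_trans hs)// le_coord_norm.
      by rewrite mulr0 addr0; case: ifP; rewrite ?normr0// le_coord_norm.
    by move=> /Hr/(_ j).
  move=> /le_trans; apply.
  rewrite sumr_const card_ord -mulr_natr /e' -mulrA mulrC ler_wpM2r//.
  by rewrite -mulrA ger_pMr// mulrC ler_pdivrMr// mul1r ler_nat.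
have dfE : 'd f x = row_form p :> ('rV[R]_N -> R).
  by apply: diff_unique => //; exact: row_form_continuous.
split=> //; apply/diff_locallyP; rewrite dfE; split=> //.
exact: row_form_continuous.
Qed.

End Differentiability.

Lemma derive_line (V W : normedModType R) (f : V -> W) (x v : V) :
  'D_v f x = 'D_1 (fun h : R => f (h *: v + x)) 0.
Proof.
rewrite /derive; set g1 := fun h => h^-1 *: _; set g2 := fun h => h^-1 *: _.
suff -> : g1 = g2 by [].
by rewrite funeqE /g1 /g2 => h /=; rewrite addr0 scale0r add0r [_%:A]mulr1.
Qed.

(** The inner map need only have a derivative along one line, but the outer map
    must be differentiable in the strong sense; this is where the continuity of
    its partial derivatives is used. *)
Lemma derive_row_comp (m N : nat) (F : 'rV[R]_N -> R)
    (G : 'rV[R]_m -> 'rV[R]_N) (x v : 'rV[R]_m) :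
  (forall j, \forall y \near G x, derivable F y (delta_mx 0 j)) ->
  (forall j, {for G x, continuous (fun y => 'D_(delta_mx 0 j) F y)}) ->
  (forall j, derivable (fun y => G y 0 j) x v) ->
  derivable (F \o G) x v /\ 'D_v (F \o G) x =
    \sum_j 'D_v (fun y => G y 0 j) x * 'D_(delta_mx 0 j) F (G x).
Proof.
move=> Fd Fc Gd.
have [Fdiff FE] := differentiable_partials Fd Fc.
have Gv : derivable G x v by apply/derivable_mxP => i j; rewrite ord1.
pose c (h : R) : 'rV[R]_N := G (h *: v + x).
have c0 : c 0 = G x by rewrite /c scale0r add0r.
have cd : differentiable c (0 : R).
  by apply: (derivable1_diffP c 0).1; exact: ((derivable1P G x v).1 Gv).
have Fd0 : differentiable F (c 0) by rewrite c0.
have Fc_diff : differentiable (F \o c) (0 : R) by exact: differentiable_comp.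
split.
  apply: (derivable1P (F \o G) x v).2.
  exact: (derivable1_diffP (F \o c) 0).2 Fc_diff.
rewrite derive_line (deriveE _ Fc_diff) diff_comp//= -(deriveE _ cd).
have <- : 'D_v G x = 'D_1 c 0 by rewrite derive_line.
have -> : 'd F (c 0) = 'd F (G x) :> (_ -> _) by rewrite c0.
rewrite FE /row_form; apply: eq_bigr => j _; rewrite mxE; congr (_ * _).
by rewrite derive_mx// mxE.
Qed.

Lemma continuous_row (T : topologicalType) (N : nat) (G : T -> 'rV[R]_N) (x : T) :
  (forall j, {for x, continuous (fun y => G y 0 j)}) -> {for x, continuous G}.
Proof.
move=> Gc; apply/cvgrPdist_le => e e0.
have : \forall y \near x, forall j, `|G x 0 j - G y 0 j| <= e.
  apply: (@filter_forall _ 'I_N (fun j y => `|G x 0 j - G y 0 j| <= e)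
    (nbhs x) (nbhs_filter x)) => j.
  by move/cvgrPdist_le : (Gc j) => /(_ _ e0).
apply: filterS => y hy; apply: norm_row_le; first exact: ltW.
by move=> j; rewrite !mxE.
Qed.

Section Ck.
Variable m : nat.
Implicit Types (U : set 'rV[R]_m) (f g : 'rV[R]_m -> R) (x : 'rV[R]_m).

Lemma Ck_on_continuous k U f :
  Ck_on k U f -> forall x, U x -> {for x, continuous f}.
Proof. by case: k => [|k] []. Qed.

Lemma Ck_onS k U f : Ck_on k.+1 U f -> Ck_on k U f.
Proof.
elim: k f => [|k IH] f /= [fc fd]; split=> // i; have [d C] := fd i.
by split=> //; exact: IH.
Qed.

Lemma Ck_on_subset k U V f : V `<=` U -> Ck_on k U f -> Ck_on k V f.
Proof.
move=> VU; elim: k f => [|k IH] f /= [fc fd]; split=> [x /VU/fc//|//] i.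
have [d C] := fd i; split; first by move=> x /VU/d.
exact: IH.
Qed.

Lemma Ck_on_eq k U f g : open U -> {in U, f =1 g} -> Ck_on k U f -> Ck_on k U g.
Proof.
move=> Uo.
have near_eq f' g' : {in U, f' =1 g'} -> forall x, U x -> \forall y \near x, f' y = g' y.
  move=> fg x Ux; apply: filterS (open_nbhs_nbhs (conj Uo Ux)) => y Uy.
  exact/fg/mem_set.
have eq_cont f' g' : {in U, f' =1 g'} -> (forall x, U x -> {for x, continuous f'}) ->
    forall x, U x -> {for x, continuous g'}.
  move=> fg fc x Ux; rewrite /prop_for /continuous_at -(fg x (mem_set Ux)).
  apply: cvg_trans (fc x Ux).
  exact: (@near_eq_cvg _ _ (nbhs x) (nbhs_filter x) _ _ (near_eq _ _ fg x Ux)).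
elim: k f g => [|k IH] f g fg [fc fd]; (split; first exact: eq_cont fg fc) => //.
move=> i; have [d C] := fd i; have near_fg := near_eq _ _ fg; split.
  by move=> x Ux; apply: near_eq_derivable (d x Ux); exact: near_fg.
apply: IH C => x /set_mem Ux.
by apply: near_eq_derive; exact: near_fg.
Qed.

Lemma Ck_on_cst k U (a : R) : open U -> Ck_on k U (fun=> a).
Proof.
move=> Uo; elim: k a => [|k IH] a; (split=> [x _|]; first exact: (@cst_continuous _ _ a x)) => //.
move=> i; split; first by move=> x _; exact: derivable_cst.
by apply: (@Ck_on_eq _ _ (fun=> 0)) => // x _; rewrite derive_cst.
Qed.

Lemma Ck_onD k U f g : open U -> Ck_on k U f -> Ck_on k U g ->
  Ck_on k U (fun x => f x + g x).
Proof.
move=> Uo; elim: k f g => [|k IH] f g [fc fd] [gc gd].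
all: split=> [x Ux|//].
1,2: exact: continuousD (fc x Ux) (gc x Ux).
move=> i; have [df Cf] := fd i; have [dg Cg] := gd i.
split; first by move=> x Ux; exact: derivableD (df x Ux) (dg x Ux).
apply: Ck_on_eq (IH _ _ Cf Cg) => // x /set_mem Ux.
by rewrite -deriveD//; [exact: df|exact: dg].
Qed.

Lemma Ck_onM k U f g : open U -> Ck_on k U f -> Ck_on k U g ->
  Ck_on k U (fun x => f x * g x).
Proof.
move=> Uo; elim: k f g => [|k IH] f g Cf Cg.
all: split=> [x Ux|//].
1,2: exact: continuousM (Ck_on_continuous Cf Ux) (Ck_on_continuous Cg Ux).
move=> i; have [df Df] := Cf.2 i; have [dg Dg] := Cg.2 i.
split; first by move=> x Ux; exact: derivableM (df x Ux) (dg x Ux).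
apply: Ck_on_eq (Ck_onD Uo (IH _ _ (Ck_onS Cf) Dg) (IH _ _ (Ck_onS Cg) Df)) => //.
by move=> x /set_mem Ux; rewrite deriveM//; [exact: df|exact: dg].
Qed.

Lemma Ck_on_sum k U (I : Type) (r : seq I) (F : I -> 'rV[R]_m -> R) : open U ->
  (forall i, Ck_on k U (F i)) -> Ck_on k U (fun x => \sum_(i <- r) F i x).
Proof.
move=> Uo CF; elim: r => [|i r IH].
  by apply: Ck_on_eq (Ck_on_cst _ 0 Uo) => // x _; rewrite big_nil.
by apply: Ck_on_eq (Ck_onD Uo (CF i) IH) => // x _; rewrite big_cons.
Qed.

Lemma cinf_at_eq f g x : (\forall y \near x, f y = g y) -> cinf_at f x -> cinf_at g x.
Proof.
rewrite /prop_near1 nbhsE => -[V [Vo Vx] fg] [U [Uo Ux] Cf].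
exists (U `&` V); first by split=> //; exact: openI.
move=> k; apply: Ck_on_eq (Ck_on_subset (@subIsetl _ U V) (Cf k)).
  exact: openI.
by move=> y /set_mem[_ /fg].
Qed.

Lemma cinf_at_near f x : cinf_at f x -> \forall y \near x, cinf_at f y.
Proof.
move=> [U Ux Cf]; apply: filterS (open_nbhs_nbhs Ux) => y Uy.
by exists U => //; split=> //; case: Ux.
Qed.

Lemma cinf_at_cst (a : R) (x : 'rV[R]_m) : cinf_at (fun=> a) x.
Proof.
exists setT; first by split=> //; exact: openT.
by move=> k; apply: Ck_on_cst; exact: openT.
Qed.

Lemma cinf_atD f g x : cinf_at f x -> cinf_at g x -> cinf_at (fun y => f y + g y) x.
Proof.
move=> [U [Uo Ux] Cf] [V [Vo Vx] Cg].
exists (U `&` V); first by split=> //; exact: openI.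
by move=> k; apply: Ck_onD; [exact: openI|exact: Ck_on_subset (Cf k)|exact: Ck_on_subset (Cg k)].
Qed.

Lemma cinf_atM f g x : cinf_at f x -> cinf_at g x -> cinf_at (fun y => f y * g y) x.
Proof.
move=> [U [Uo Ux] Cf] [V [Vo Vx] Cg].
exists (U `&` V); first by split=> //; exact: openI.
by move=> k; apply: Ck_onM; [exact: openI|exact: Ck_on_subset (Cf k)|exact: Ck_on_subset (Cg k)].
Qed.

End Ck.

(** By induction on [k]: the chain rule writes a partial derivative of the
    composite as a sum of products of functions of class C^k. *)
Lemma Ck_on_comp k m N (U : set 'rV[R]_m) (W : set 'rV[R]_N) (F : 'rV[R]_N -> R)
    (G : 'rV[R]_m -> 'rV[R]_N) :
  open U -> open W -> (forall x, U x -> W (G x)) ->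
  (forall j, Ck_on k U (fun x => G x 0 j)) -> Ck_on k W F ->
  Ck_on k U (F \o G).
Proof.
move=> Uo Wo GUW; elim: k F => [|k IH] F CG CF.
all: split=> [x Ux|//].
1,2: apply: continuous_comp; last exact: (Ck_on_continuous CF (GUW _ Ux)).
1,2: by apply: continuous_row => j; exact: (Ck_on_continuous (CG j) Ux).
move=> i.
have chain x : U x -> derivable (F \o G) x (delta_mx 0 i) /\
    'D_(delta_mx 0 i) (F \o G) x =
    \sum_j 'D_(delta_mx 0 i) (fun y => G y 0 j) x * 'D_(delta_mx 0 j) F (G x).
  move=> Ux; apply: derive_row_comp => j.
  - apply: filterS (open_nbhs_nbhs (conj Wo (GUW _ Ux))) => y Wy.
    exact: (CF.2 j).1.
  - exact: (Ck_on_continuous (CF.2 j).2 (GUW _ Ux)).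
  - exact: ((CG j).2 i).1.
split; first by move=> x /chain[].
apply: (@Ck_on_eq _ _ _ (fun x => \sum_j
    'D_(delta_mx 0 i) (fun y => G y 0 j) x * 'D_(delta_mx 0 j) F (G x))) => //.
  by move=> x /set_mem/chain[].
apply: Ck_on_sum => // j; apply: Ck_onM => //; first exact: ((CG j).2 i).2.
apply: (IH (fun y => 'D_(delta_mx 0 j) F y)); last exact: (CF.2 j).2.
by move=> j'; exact: Ck_onS.
Qed.

(** Smooth functions on a product are defined as smooth functions of smooth
    functions of the two factors; this is what makes their restriction to a
    slice smooth. *)
Lemma cinf_at_comp m N (F : 'rV[R]_N -> R) (G : 'rV[R]_m -> 'rV[R]_N) x :
  (forall j, cinf_at (fun y => G y 0 j) x) -> cinf_at F (G x) -> cinf_at (F \o G) x.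
Proof.
move=> CG [W [Wo WGx] CF].
have {CG} [U [Uo Ux] CG] : exists2 U, open_nbhs x U &
    forall k j, Ck_on k U (fun y => G y 0 j).
  have /choice[U HU] : forall j, exists U, open_nbhs x U /\
      forall k, Ck_on k U (fun y => G y 0 j).
    by move=> j; have [U] := CG j; exists U.
  have : \forall y \near x, forall j, U j y.
    apply: (@filter_forall _ 'I_N (fun j y => U j y) (nbhs x) (nbhs_filter x)) => j.
    exact: open_nbhs_nbhs (HU j).1.
  rewrite /prop_near1 nbhsE => -[V Vx VU]; exists V => // k j.
  by apply: Ck_on_subset ((HU j).2 k) => y /VU.
have Gc y : U y -> {for y, continuous G}.
  by move=> Uy; apply: continuous_row => j; exact: (Ck_on_continuous (CG 0%N j)).
have UWo : open (U `&` G @^-1` W).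
  rewrite openE => y [Uy Wy]; apply: filterI; first exact: open_nbhs_nbhs.
  exact/(Gc y Uy)/open_nbhs_nbhs.
exists (U `&` G @^-1` W) => // k.
apply: (@Ck_on_comp _ _ _ _ W) => // [y []//|j].
by apply: Ck_on_subset (CG k j) => y [].
Qed.

End Calculus.

(** * Smooth functions and vector fields on a manifold *)

Section SmoothFunctions.
Context {R : realType} {m : nat} {X : smooth_space R}.
Hypothesis X_manifold : is_manifold m X.
Implicit Types (f g : X -> R) (x : X).

Lemma chart_at x : exists (U : set X) (V : set 'rV[R]_m) phi psi,
  U x /\ is_chart U V phi psi.
Proof. by case: X_manifold. Qed.

Lemma smooth_at_eq f g x :
  (\forall y \near x, f y = g y) -> smooth_at f x -> smooth_at g x.
Proof.
move=> fg; have [U [V [phi [psi [Ux [_ hU hV [_ psic] H]]]]]] := chart_at x.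
have [Vx xK] := hU x Ux.
move=> /(H f x Ux) Cf; apply/(H g x Ux); apply: cinf_at_eq Cf.
have : nbhs (psi (phi x)) [set y | f y = g y] by rewrite xK.
by move=> /(psic _ Vx).
Qed.

Lemma smooth_at_near f x : smooth_at f x -> \forall y \near x, smooth_at f y.
Proof.
have [U [V [phi [psi [Ux [[Uo _] hU hV [phic _] H]]]]]] := chart_at x.
move=> /(H f x Ux)/cinf_at_near Cf.
have {}Cf : nbhs x [set y | cinf_at (f \o psi) (phi y)].
  by apply: (phic _ Ux); exact: Cf.
apply: filterS2 Cf (open_nbhs_nbhs (conj Uo Ux)) => y Cy Uy.
exact/(H f y Uy).
Qed.

Lemma smooth_at_cst (a : R) x : smooth_at (fun=> a : R) x.
Proof.
have [U [V [phi [psi [Ux [_ _ _ _ H]]]]]] := chart_at x.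
exact/(H _ x Ux)/cinf_at_cst.
Qed.

Lemma smooth_cst (a : R) : smooth (fun _ : X => a).
Proof. by move=> x; exact: smooth_at_cst. Qed.

Lemma smooth_atD f g x : smooth_at f x -> smooth_at g x ->
  smooth_at (fun y => f y + g y) x.
Proof.
have [U [V [phi [psi [Ux [_ _ _ _ H]]]]]] := chart_at x.
move=> /(H _ x Ux) Cf /(H _ x Ux) Cg; apply/(H _ x Ux).
exact: (cinf_atD Cf Cg).
Qed.

Lemma smooth_atM f g x : smooth_at f x -> smooth_at g x ->
  smooth_at (fun y => f y * g y) x.
Proof.
have [U [V [phi [psi [Ux [_ _ _ _ H]]]]]] := chart_at x.
move=> /(H _ x Ux) Cf /(H _ x Ux) Cg; apply/(H _ x Ux).
exact: (cinf_atM Cf Cg).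
Qed.

Lemma smooth_at_comp N (F : 'rV[R]_N -> R) (G : X -> 'rV[R]_N) x :
  (forall j, smooth_at (fun y => G y 0 j) x) -> cinf_at F (G x) ->
  smooth_at (fun y => F (G y)) x.
Proof.
have [U [V [phi [psi [Ux [_ hU _ _ H]]]]]] := chart_at x.
have [_ xK] := hU x Ux.
move=> CG CF; apply/(H _ x Ux).
apply: (@cinf_at_comp _ _ _ F (G \o psi)); last by rewrite /= xK.
by move=> j; exact: ((H (fun y => G y 0 j) x Ux).1 (CG j)).
Qed.

Lemma smooth_atZ (a : R) f x : smooth_at f x -> smooth_at (fun y => a * f y) x.
Proof. exact/smooth_atM/smooth_at_cst. Qed.

Lemma smooth_atN f x : smooth_at f x -> smooth_at (fun y => - f y) x.
Proof.
move=> /(smooth_atZ (-1)); apply: smooth_at_eq.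
by apply: nearW => y; rewrite mulN1r.
Qed.

Lemma smooth_atB f g x : smooth_at f x -> smooth_at g x ->
  smooth_at (fun y => f y - g y) x.
Proof. by move=> Sf Sg; apply: smooth_atD => //; exact: smooth_atN. Qed.

Lemma smooth_at_sum (I : Type) (r : seq I) (F : I -> X -> R) x :
  (forall i, smooth_at (F i) x) -> smooth_at (fun y => \sum_(i <- r) F i y) x.
Proof.
move=> SF; elim: r => [|i r IH].
  by apply: smooth_at_eq (smooth_at_cst 0 x); apply: nearW => y; rewrite big_nil.
apply: smooth_at_eq (smooth_atD (SF i) IH).
by apply: nearW => y; rewrite big_cons.
Qed.

Section Tangent.
Variables (x : X) (v : (X -> R) -> R).
Hypothesis v_tangent : tangent x v.

Lemma tangent_eq f g : (\forall y \near x, f y = g y) -> smooth_at f x -> v f = v g.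
Proof.
case: v_tangent => vE _ _ _ fg Sf; apply: vE => //.
exact: smooth_at_eq Sf.
Qed.

Lemma tangentD f g : smooth_at f x -> smooth_at g x ->
  v (fun y => f y + g y) = v f + v g.
Proof.
case: v_tangent => _ vL _ _ Sf Sg; rewrite -[v f]mul1r -vL//; congr v.
by apply/funext => y; rewrite mul1r.
Qed.

Lemma tangent0 : v (fun=> 0) = 0.
Proof.
case: v_tangent => _ vL _ _; have S0 := smooth_at_cst 0 x.
have := vL (-1) _ _ S0 S0; rewrite (_ : (fun _ => _) = (fun=> 0 : R)).
  by rewrite mulN1r addNr.
by apply/funext => y; rewrite addr0 mulr0.
Qed.

Lemma tangentZ (a : R) f : smooth_at f x -> v (fun y => a * f y) = a * v f.
Proof.
case: v_tangent => _ vL _ _ Sf; have := vL a _ _ Sf (smooth_at_cst 0 x).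
rewrite tangent0 addr0 => <-; congr v.
by apply/funext => y; rewrite addr0.
Qed.

Lemma tangentN f : smooth_at f x -> v (fun y => - f y) = - v f.
Proof.
move=> /(tangentZ (-1)); rewrite mulN1r => <-; congr v.
by apply/funext => y; rewrite mulN1r.
Qed.

Lemma tangentB f g : smooth_at f x -> smooth_at g x ->
  v (fun y => f y - g y) = v f - v g.
Proof.
by move=> Sf Sg; rewrite tangentD//; [rewrite tangentN|exact: smooth_atN].
Qed.

Lemma tangentM f g : smooth_at f x -> smooth_at g x ->
  v (fun y => f y * g y) = v f * g x + f x * v g.
Proof. by case: v_tangent => _ _ vM _; exact: vM. Qed.

Lemma tangent_sum (I : Type) (r : seq I) (F : I -> X -> R) :
  (forall i, smooth_at (F i) x) ->
  v (fun y => \sum_(i <- r) F i y) = \sum_(i <- r) v (F i).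
Proof.
move=> SF; elim: r => [|i r IH].
  rewrite big_nil -[RHS]tangent0; congr v.
  by apply/funext => y; rewrite big_nil.
rewrite big_cons -IH -tangentD//; last exact: smooth_at_sum.
by congr v; apply/funext => y; rewrite big_cons.
Qed.

End Tangent.

Lemma tangent_comb (x : X) (a : R) (v w : (X -> R) -> R) :
  tangent x v -> tangent x w -> tangent x (fun f => a * v f + w f).
Proof.
move=> [vE vL vM v0] [wE wL wM w0]; split=> [f g Sf Sg fg|b f g Sf Sg|f g Sf Sg|f nSf].
- by rewrite (vE f g)// (wE f g).
- by rewrite vL// wL//; ring.
- by rewrite vM// wM//; ring.
- by rewrite v0// w0//; ring.
Qed.

Section Fields.
Implicit Types (Y Z : vect X).

Lemma vfield_comb (h : X -> R) Y Z : smooth h -> vfield Y -> vfield Z ->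
  vfield (vcomb h Y Z).
Proof.
move=> Sh [Yt Ys] [Zt Zs]; split=> [p|f p Sf]; first exact: tangent_comb.
by apply: smooth_atD; [apply: smooth_atM; [exact: Sh|exact: Ys]|exact: Zs].
Qed.

Lemma vfield0 : vfield (@vzero R X).
Proof.
split=> [p|f p _]; last exact: smooth_at_cst.
by split=> *; rewrite /vzero; ring.
Qed.

Lemma bracketE Y Z p f : smooth_at f p ->
  bracket Y Z p f = Y p (fun q => Z q f) - Z p (fun q => Y q f).
Proof. by move=> Sf; rewrite /bracket; case: asboolP. Qed.

Lemma bracket_nonsmooth Y Z p f : ~ smooth_at f p -> bracket Y Z p f = 0.
Proof. by move=> nSf; rewrite /bracket; case: asboolP. Qed.

(** Tangent vectors at nearby points only see germs, and two functions that
    agree near [p] have equal germs at all points near [p]. *)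
Lemma vfield_eq_near Y f g p : vfield Y -> smooth_at f p -> smooth_at g p ->
  (\forall q \near p, f q = g q) -> \forall q \near p, Y q f = Y q g.
Proof.
move=> [Yt _] Sf Sg; move=> /nbhs_interior fg.
apply: filterS3 (smooth_at_near Sf) (smooth_at_near Sg) fg => q ? ? ?.
by move: (Yt q) => [vE _ _ _]; exact: vE.
Qed.

(** Second derivatives of [f g] contain mixed terms in the first derivatives of
    [f] and [g]; they are symmetric in the two fields and cancel in the
    commutator. *)
Lemma vfield_bracket Y Z : vfield Y -> vfield Z -> vfield (bracket Y Z).
Proof.
move=> Yf Zf; have [Yt Ys] := Yf; have [Zt Zs] := Zf; split=> [p|f p Sf].
  split=> [f g Sf Sg fg|a f g Sf Sg|f g Sf Sg|f nSf].
  - rewrite !bracketE//; congr (_ - _).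
      by apply: (tangent_eq (Yt p)); [exact: vfield_eq_near|exact: Zs].
    by apply: (tangent_eq (Zt p)); [exact: vfield_eq_near|exact: Ys].
  - have S : smooth_at (fun q => a * f q + g q) p.
      by apply: smooth_atD => //; exact: smooth_atZ.
    have lin W : vfield W -> \forall q \near p,
        W q (fun r => a * f r + g r) = a * W q f + W q g.
      move=> [Wt _]; apply: filterS2 (smooth_at_near Sf) (smooth_at_near Sg).
      by move=> q ? ?; case: (Wt q) => _ vL _ _; exact: vL.
    rewrite !bracketE//.
    rewrite (tangent_eq (Yt p) (lin _ Zf)); last exact: Zs.
    rewrite (tangent_eq (Zt p) (lin _ Yf)); last exact: Ys.
    rewrite (tangentD (Yt p)); [|exact/smooth_atZ/Zs|exact: Zs].
    rewrite (tangentD (Zt p)); [|exact/smooth_atZ/Ys|exact: Ys].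
    rewrite (tangentZ (Yt p)); [|exact: Zs].
    rewrite (tangentZ (Zt p)); [|exact: Ys].
    ring.
  - have S : smooth_at (fun q => f q * g q) p by exact: smooth_atM.
    have lei W : vfield W -> \forall q \near p,
        W q (fun r => f r * g r) = W q f * g q + f q * W q g.
      move=> [Wt _]; apply: filterS2 (smooth_at_near Sf) (smooth_at_near Sg).
      by move=> q ? ?; exact: tangentM.
    have lei2 V W : vfield V -> vfield W ->
        V p (fun q => W q (fun r => f r * g r)) =
        V p (fun q => W q f) * g p + W p f * V p g +
        (V p f * W p g + f p * V p (fun q => W q g)).
      move=> [Vt _] Wf; have [_ Ws] := Wf.
      rewrite (tangent_eq (Vt p) (lei _ Wf)); last exact: Ws.
      rewrite (tangentD (Vt p)); first by rewrite !(tangentM (Vt p))//; exact: Ws.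
        by apply: smooth_atM => //; exact: Ws.
      by apply: smooth_atM => //; exact: Ws.
    by rewrite !bracketE// !lei2//; ring.
  - exact: bracket_nonsmooth.
apply: (@smooth_at_eq (fun q => Y q (fun r => Z r f) - Z q (fun r => Y r f))).
  by apply: filterS (smooth_at_near Sf) => q Sq; rewrite bracketE.
by apply: smooth_atB; [apply: Ys; exact: Zs|apply: Zs; exact: Ys].
Qed.

Lemma bracketN Y Z p f : bracket Y Z p f = - bracket Z Y p f.
Proof. by rewrite /bracket; case: asboolP => _; ring. Qed.

Lemma bracket_swap Y Z : bracket Y Z = vcomb (fun=> -1) (bracket Z Y) (@vzero R X).
Proof. by do 2 apply/funext => ?; rewrite bracketN /vcomb /vzero; ring. Qed.

Lemma vfield_bracket2 Y Z W p f : vfield Y -> vfield Z -> vfield W -> smooth_at f p ->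
  bracket (bracket Y Z) W p f =
  Y p (fun q => Z q (fun r => W r f)) - Z p (fun q => Y q (fun r => W r f)) -
  (W p (fun q => Y q (fun r => Z r f)) - W p (fun q => Z q (fun r => Y r f))).
Proof.
move=> [_ Ys] [_ Zs] [Wt Ws] Sf; rewrite bracketE// bracketE; last exact: Ws.
congr (_ - _); rewrite -(tangentB (Wt p)); [|by apply: Ys; exact: Zs|by apply: Zs; exact: Ys].
apply/esym/(tangent_eq (Wt p)).
  by apply: filterS (smooth_at_near Sf) => q Sq; rewrite bracketE.
by apply: smooth_atB; [apply: Ys; exact: Zs|apply: Zs; exact: Ys].
Qed.

(** The sum and the zero field are expressed through [vcomb], so that a
    differential form can be applied to both sides. *)
Lemma jacobi Y Z W : vfield Y -> vfield Z -> vfield W ->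
  vcomb (fun=> 1) (bracket (bracket Y Z) W)
    (vcomb (fun=> 1) (bracket (bracket Z W) Y) (bracket (bracket W Y) Z)) = @vzero R X.
Proof.
move=> Yf Zf Wf; apply/funext => p; apply/funext => f; rewrite /vcomb /vzero.
have [Sf|nSf] := pselect (smooth_at f p).
  by rewrite !vfield_bracket2//; ring.
by rewrite !bracket_nonsmooth//; ring.
Qed.

End Fields.
End SmoothFunctions.

(** * Finite-dimensional coordinates and the splitting of u_n *)

Section Coordinates.
Context {R : realType}.
Implicit Types V W : lmodType R.

(** Finite dimension in the form that [vder] needs: finitely many vectors and
    linear forms that reconstruct every vector. *)
Definition finite_coords V : Prop :=
  exists (I : finType) (e : I -> V) (l : I -> {linear V -> R^o}),
    forall v, v = \sum_i l i v *: e i.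

Lemma finite_coords_retract V W (s : {linear W -> V}) (r : {linear V -> W}) :
  cancel s r -> finite_coords V -> finite_coords W.
Proof.
move=> sK [I [e [l el]]]; exists I, (r \o e), (fun i => l i \o s : {linear W -> R^o}).
move=> w; rewrite -[LHS]sK [s w]el linear_sum; apply: eq_bigr => i _.
by rewrite linearZ.
Qed.

Lemma coords_separate V (v w : V) : finite_coords V ->
  (forall l : {linear V -> R^o}, l v = l w) -> v = w.
Proof.
by move=> [I [e [l el]]] vw; rewrite (el v) (el w); apply: eq_bigr => i _; rewrite vw.
Qed.

Section Derivative.
Context {m : nat} {X : smooth_space R}.
Hypothesis X_manifold : is_manifold m X.

Section OneSpace.
Context {V : lmodType R}.
Hypothesis V_coords : finite_coords V.

(** The vector whose coordinates are the derivatives of the coordinates of [f]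
    satisfies the condition that defines [vder], because a tangent vector
    commutes with finite linear combinations. *)
Lemma vder_linear_form (Y : vect X) (f : X -> V) p : tangent p (Y p) ->
  (forall l : {linear V -> R^o}, smooth_at (l \o f : X -> R) p) ->
  forall l : {linear V -> R^o}, l (vder Y f p) = Y p (l \o f).
Proof.
move=> Yp Sf; rewrite /vder; case: xgetP => [v _ //|/(_ _) H].
have [I [e [l el]]] := V_coords.
case: (H (\sum_i Y p (l i \o f) *: e i)) => k.
have -> : k \o f = fun q => \sum_i k (e i) * (l i \o f) q.
  apply/funext => q; rewrite /= [in LHS](el (f q)) linear_sum.
  by apply: eq_bigr => i _; rewrite linearZ /= mulrC.
rewrite (tangent_sum X_manifold Yp); last first.
  by move=> i; apply: (smooth_atZ X_manifold).
rewrite linear_sum; apply: eq_bigr => i _.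
rewrite (tangentZ X_manifold Yp _ (Sf (l i))) linearZ.
exact: mulrC.
Qed.

Lemma vder0 (Y : vect X) p : tangent p (Y p) -> vder Y (fun=> 0 : V) p = 0.
Proof.
move=> Yp; apply: coords_separate => // l.
have E : l \o (fun=> 0) = (fun=> 0) :> (X -> R).
  by apply/funext => q; rewrite /= linear0.
rewrite vder_linear_form//; first by rewrite E linear0 (tangent0 X_manifold Yp).
by move=> k; rewrite (_ : _ \o _ = (fun=> 0)); [exact: (smooth_at_cst X_manifold)
  |apply/funext => q; rewrite /= linear0].
Qed.

End OneSpace.

(** Both sides have the same image under each linear form, and composing a
    linear form with [T] gives a linear form again. *)
Lemma linear_vder V W (T : {linear V -> W}) (Y : vect X) (f : X -> V) p :
  finite_coords V -> finite_coords W -> tangent p (Y p) -> smooth_vec f ->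
  T (vder Y f p) = vder Y (T \o f) p.
Proof.
move=> Vc Wc Yp Sf; apply: coords_separate => // l.
rewrite (vder_linear_form Wc)//; last first.
  by move=> k; exact: (Sf (k \o T : {linear V -> R^o})).
rewrite -[l (T _)]/((l \o T : {linear V -> R^o}) _) vder_linear_form//.
by move=> k; exact: Sf.
Qed.

End Derivative.
End Coordinates.

Section UnitaryAlgebra.
Local Open Scope complex_scope.
Local Open Scope sesquilinear_scope.
Context {R : realType}.
Local Notation C := R[i].

Section Coords.
Variable n : nat.

Definition u_re (ij : 'I_n * 'I_n) (A : u_alg R n) : R^o := complex.Re (A ij.1 ij.2).
Definition u_im (ij : 'I_n * 'I_n) (A : u_alg R n) : R^o := complex.Im (A ij.1 ij.2).

Fact u_re_linear ij : linear (u_re ij).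
Proof.
move=> a A B; rewrite /u_re /= !mxE; case: (A _ _) => x y; case: (B _ _) => z t /=.
by rewrite mul0r subr0.
Qed.
Fact u_im_linear ij : linear (u_im ij).
Proof.
move=> a A B; rewrite /u_im /= !mxE; case: (A _ _) => x y; case: (B _ _) => z t /=.
by rewrite mul0r addr0.
Qed.
HB.instance Definition _ ij :=
  GRing.isLinear.Build R (u_alg R n) R^o _ (u_re ij) (u_re_linear ij).
HB.instance Definition _ ij :=
  GRing.isLinear.Build R (u_alg R n) R^o _ (u_im ij) (u_im_linear ij).

Fact skew_part_subproof (B : 'M[C]_n) : is_skewherm ((2^-1 : C) *: (B - B^t*)).
Proof.
apply/eqP/matrixP => i j; rewrite !mxE.
rewrite rmorphM rmorphB /= conjCK fmorphV rmorph_nat; ring.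
Qed.
(** The real-linear projection of all matrices onto the skew-hermitian ones. *)
Definition skew_part (B : 'M[C]_n) : u_alg R n := MkUalg (skew_part_subproof B).

(** A skew-hermitian matrix is the real combination of the elementary matrices
    and of their multiples by i, weighted by the real and imaginary parts of its
    entries; projecting to skew-hermitian matrices fixes it and turns the
    elementary matrices into elements of u_n. *)
Lemma u_alg_coords : finite_coords (u_alg R n).
Proof.
pose I : finType := (bool * ('I_n * 'I_n))%type.
pose e (k : I) := skew_part ((if k.1 then 'i%C else 1) *: delta_mx k.2.1 k.2.2).
pose l (k : I) : {linear u_alg R n -> R^o} :=
  if k.1 then (u_im k.2 : {linear _ -> _}) else (u_re k.2 : {linear _ -> _}).
exists I, e, l => A; apply: val_inj.
rewrite raddf_sum /=; apply/matrixP => i j.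
rewrite summxE -(pair_bigA _ (fun b p => (u_mx (l (b, p) A *: e (b, p))) i j)) /= big_bool /=.
have pick (a : 'I_n * 'I_n -> R) (c : C) (i0 j0 : 'I_n) :
    \sum_p (a p)%:C * (c * (delta_mx p.1 p.2 : 'M[C]_n) i0 j0) = (a (i0, j0))%:C * c.
  rewrite (bigD1 (i0, j0))//= big1 ?addr0 => [|[k k'] ne].
    by rewrite mxE !eqxx mulr1.
  rewrite mxE /=; case: eqP => [E1|_]; last by rewrite !mulr0.
  case: eqP => [E2|_]; last by rewrite !mulr0.
  by case/eqP: ne; rewrite E1 E2.
have slot (a : 'I_n * 'I_n -> R) (c : C) :
    \sum_p (u_mx (a p *: skew_part (c *: delta_mx p.1 p.2))) i j =
    2^-1 * ((a (i, j))%:C * c - (a (j, i))%:C * c^*).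
  rewrite -!pick -sumrB mulr_sumr; apply: eq_bigr => p _.
  rewrite !mxE !rmorphM /= !rmorph_nat; ring.
transitivity (2^-1 * ((complex.Im (A i j))%:C * 'i%C - (complex.Im (A j i))%:C * 'i%C^*) +
    2^-1 * ((complex.Re (A i j))%:C * 1 - (complex.Re (A j i))%:C * 1^*)); last first.
  congr (_ + _); apply/esym; first exact: (slot (fun p => complex.Im (A p.1 p.2))).
  exact: (slot (fun p => complex.Re (A p.1 p.2))).
have := congr1 (fun B : 'M[C]_n => B i j) (u_skew A).
rewrite !mxE; case: (A i j) => x y; case: (A j i) => z t.
case=> zx ty; have {zx}-> : z = - x by [].
have {ty}-> : t = y by apply: oppr_inj.
apply: (@mulfI C 2); first by rewrite pnatr_eq0.
rewrite -mulrDr mulVKf ?pnatr_eq0// rmorph1 mulr2n mulrDl !mul1r !mulr1.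
by apply/eqP; rewrite eq_complex /=; apply/andP; split; apply/eqP; ring.
Qed.


End Coords.

Section Trace.
Variable n : nat.
Hypothesis n_gt0 : (0 < n)%N.

Fact u_trace_subproof (A : u_alg R n) :
  is_skewherm ((\tr (A : 'M[C]_n) / n%:R)%:M : 'M[C]_1).
Proof.
apply/eqP; rewrite tr_scalar_mx map_scalar_mx -raddfN; congr _%:M.
rewrite /= rmorphM fmorphV rmorph_nat -mulNr; congr (_ * _).
by rewrite -raddfN -u_skew /= trace_map_mx mxtrace_tr.
Qed.
(** The trace divided by [n]: the retraction of [u_scalar] that splits off the
    centre, u_n = su_n + u_1. *)
Definition u_trace (A : u_alg R n) : u_alg R 1 := MkUalg (u_trace_subproof A).

Fact u_trace_linear : linear u_trace.
Proof.
move=> a A B; apply: val_inj; rewrite /= raddfD /= linearZ /= mulrDl -mulrA.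
by rewrite raddfD /= -scale_scalar_mx.
Qed.
HB.instance Definition _ :=
  GRing.isLinear.Build R (u_alg R n) (u_alg R 1) _ u_trace u_trace_linear.

Fact u_scalar_linear : linear (@u_scalar R n).
Proof.
move=> a z w; apply: val_inj; rewrite /= !mxE raddfD /=.
by rewrite -scale_scalar_mx.
Qed.
HB.instance Definition _ :=
  GRing.isLinear.Build R (u_alg R 1) (u_alg R n) _ (@u_scalar R n) u_scalar_linear.

Fact to_pu_linear : linear (@to_pu R n).
Proof. by move=> a A B; rewrite to_puD to_puZ. Qed.
HB.instance Definition _ :=
  GRing.isLinear.Build R (u_alg R n) (pu_alg R n) _ (@to_pu R n) to_pu_linear.

Lemma u_scalarK : cancel (@u_scalar R n) u_trace.
Proof.
move=> z; apply: val_inj; apply/matrixP => i j; rewrite !ord1 /= mxE eqxx.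
by rewrite mulr1n mxtrace_scalar -[_ *+ n]mulr_natr mulfK// pnatr_eq0 -lt0n.
Qed.

Lemma u_trace_Ad (k : PU R n) A : u_trace (PU_Ad k A) = u_trace A.
Proof.
apply: val_inj; rewrite /= mxtrace_mulC mulmxA.
have /(congr1 val)/= -> := UmulV (repr k).
by rewrite mul1mx.
Qed.

(** An element in the kernel of u_n -> pu_n is scalar, hence recovered from its
    trace. *)
Lemma to_pu_eq0 (A : u_alg R n) : to_pu A = 0 -> A = u_scalar n (u_trace A).
Proof.
move=> A0; have [z] : exists z, A - 0 = u_scalar n z by apply/to_pu_eqP; rewrite linear0.
by rewrite subr0 => ->; rewrite u_scalarK.
Qed.

(** The identification of pu_n = u_n / u_1 with su_n, which embeds pu_n linearly
    into u_n. *)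
Definition pu_traceless (x : pu_alg R n) : u_alg R n :=
  repr x - u_scalar n (u_trace (repr x)).

Lemma pu_tracelessE A : pu_traceless (to_pu A) = A - u_scalar n (u_trace A).
Proof.
have [z hz] := (to_pu_eqP (repr (to_pu A)) A).1 (to_pu_repr _).
rewrite /pu_traceless -(subrK A (repr _)) hz !linearD /= u_scalarK.
by rewrite addrACA subrr add0r.
Qed.

Fact pu_traceless_linear : linear pu_traceless.
Proof.
move=> a x y; rewrite -(to_pu_repr x) -(to_pu_repr y) -linearP !pu_tracelessE.
by rewrite linearP /= linearP scalerBr opprD addrACA.
Qed.
HB.instance Definition _ :=
  GRing.isLinear.Build R (pu_alg R n) (u_alg R n) _ pu_traceless pu_traceless_linear.

Lemma pu_tracelessK : cancel pu_traceless (@to_pu R n).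
Proof.
move=> x; rewrite /pu_traceless linearB /= to_pu_repr.
rewrite (_ : to_pu (u_scalar _ _) = 0) ?subr0// -(linear0 (@to_pu R n)).
by apply/to_pu_eqP; exists (u_trace (repr x)); rewrite subr0.
Qed.

Lemma pu_alg_coords : finite_coords (pu_alg R n).
Proof. exact: finite_coords_retract pu_tracelessK (u_alg_coords n). Qed.

End Trace.
End UnitaryAlgebra.

(** * The exterior derivative of a real-valued 2-form *)

Section RealTwoForms.
Context {R : realType} {m : nat} {X : smooth_space R}.
Hypothesis X_manifold : is_manifold m X.
Variable B : vect X -> vect X -> X -> R.
Implicit Types (Y Z W T : vect X).

(** Linear forms reduce vector-valued 2-forms to this case, in which the
    identities below are identities of real numbers. *)
Definition real_two_form : Prop :=
  [/\ forall Y Z, vfield Y -> vfield Z -> smooth (B Y Z),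
      forall (h : X -> R) Y Z W p, smooth h -> vfield Y -> vfield Z -> vfield W ->
        B (vcomb h Y Z) W p = h p * B Y W p + B Z W p
    & forall Y Z p, vfield Y -> vfield Z -> B Y Z p = - B Z Y p].

Hypothesis B_form : real_two_form.

Definition real_extd3 Y Z W p : R :=
  Y p (B Z W) - Z p (B Y W) + W p (B Y Z)
  - B (bracket Y Z) W p + B (bracket Y W) Z p - B (bracket Z W) Y p.

Let smB Y Z : vfield Y -> vfield Z -> smooth (B Y Z). Proof. by case: B_form => H _ _; exact: H. Qed.
Let BL h Y Z W p : smooth h -> vfield Y -> vfield Z -> vfield W ->
  B (vcomb h Y Z) W p = h p * B Y W p + B Z W p.
Proof. by case: B_form => _ H _; exact: H. Qed.
Let BN Y Z p : vfield Y -> vfield Z -> B Y Z p = - B Z Y p.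
Proof. by case: B_form => _ _ H; exact: H. Qed.

Let cst_smooth (a : R) : smooth (fun _ : X => a).
Proof. exact: (smooth_cst X_manifold). Qed.

Let vbr Y Z : vfield Y -> vfield Z -> vfield (bracket Y Z).
Proof. move=> Yf Zf; exact: (vfield_bracket X_manifold Yf Zf). Qed.

Lemma two_form0 W p : vfield W -> B (@vzero R X) W p = 0.
Proof.
move=> Wf; have V0 := vfield0 X_manifold.
have := @BL _ _ _ _ p (@cst_smooth (-1)) V0 V0 Wf.
rewrite (_ : vcomb _ _ _ = @vzero R X); first by move=> ->; ring.
by apply/funext => q; apply/funext => f; rewrite /vcomb /vzero; ring.
Qed.

Lemma two_form_bracketN Y Z W p : vfield Y -> vfield Z -> vfield W ->
  B (bracket Y Z) W p = - B (bracket Z Y) W p.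
Proof.
move=> Yf Zf Wf; rewrite bracket_swap BL//.
- by rewrite two_form0//; ring.
- exact: vbr.
- exact: vfield0 X_manifold.
Qed.

Lemma real_extd3_swap12 Y Z W p : vfield Y -> vfield Z -> vfield W ->
  real_extd3 Y Z W p = - real_extd3 Z Y W p.
Proof.
move=> Yf Zf Wf; rewrite /real_extd3 (two_form_bracketN p Yf Zf Wf).
have -> : B Y Z = fun q => - B Z Y q by apply/funext => q; exact: BN.
by rewrite (tangentN X_manifold (Wf.1 p)); [ring|exact: smB].
Qed.

Lemma real_extd3_swap23 Y Z W p : vfield Y -> vfield Z -> vfield W ->
  real_extd3 Y Z W p = - real_extd3 Y W Z p.
Proof.
move=> Yf Zf Wf; rewrite /real_extd3 (two_form_bracketN p Zf Wf Yf).
have -> : B Z W = fun q => - B W Z q by apply/funext => q; exact: BN.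
by rewrite (tangentN X_manifold (Yf.1 p)); [ring|exact: smB].
Qed.

(** The commutator with [W] also differentiates the coefficient [h]; this is the
    term that must cancel in [real_extd3_comb]. *)
Let bracket_comb (h : X -> R) Y Z W : smooth h -> vfield Y -> vfield Z -> vfield W ->
  bracket (vcomb h Y Z) W =
  vcomb h (bracket Y W) (vcomb (fun q => - W q h) Y (bracket Z W)).
Proof.
move=> Sh Yf Zf Wf; apply/funext => p; apply/funext => f.
rewrite /vcomb; have [Sf|nSf] := pselect (smooth_at f p); last first.
  by rewrite !bracket_nonsmooth//; case: (Yf.1 p) => _ _ _ ->//; ring.
have SY := Yf.2 f p Sf; have SZ := Zf.2 f p Sf.
rewrite !bracketE// (tangentD (Wf.1 p))//; last first.
  by apply: (smooth_atM X_manifold) => //; exact: Sh.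
rewrite (tangentM (Wf.1 p))//; ring.
Qed.

(** The terms with a derivative of [h] arise once from differentiating [B] and
    once from [bracket_comb], with opposite signs. *)
Lemma real_extd3_comb (h : X -> R) Y Y' Z W p :
  smooth h -> vfield Y -> vfield Y' -> vfield Z -> vfield W ->
  real_extd3 (vcomb h Y Y') Z W p = h p * real_extd3 Y Z W p + real_extd3 Y' Z W p.
Proof.
move=> Sh Yf Y'f Zf Wf; rewrite /real_extd3 !bracket_comb//.
have der T U : vfield T -> vfield U -> T p (B (vcomb h Y Y') U) =
    T p h * B Y U p + h p * T p (B Y U) + T p (B Y' U).
  move=> Tf Uf; have -> : B (vcomb h Y Y') U = fun q => h q * B Y U q + B Y' U q.
    by apply/funext => q; exact: BL.
  have SY : smooth_at (B Y U) p by exact: smB.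
  rewrite (tangentD (Tf.1 p)); [|apply: (smooth_atM X_manifold) => //; exact: Sh|exact: smB].
  by rewrite (tangentM (Tf.1 p))//; exact: Sh.
rewrite !der// {1}/vcomb.
have br T U : vfield T -> vfield U -> B (vcomb h (bracket Y T)
    (vcomb (fun q => - T q h) Y (bracket Y' T))) U p =
    h p * B (bracket Y T) U p - T p h * B Y U p + B (bracket Y' T) U p.
  move=> Tf Uf; have Th : smooth (fun q => - T q h).
    by move=> q; apply: (smooth_atN X_manifold); apply: Tf.2; exact: Sh.
  rewrite BL//; [|exact: vbr|by apply: (vfield_comb X_manifold) => //; exact: vbr].
  by rewrite BL//; [ring|exact: vbr].
rewrite !br//.
have -> : B (bracket Z W) (vcomb h Y Y') p =
    h p * B (bracket Z W) Y p + B (bracket Z W) Y' p.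
  have ZWf := vbr Zf Wf; have Cf := vfield_comb X_manifold Sh Yf Y'f.
  by rewrite BN// BL// (@BN (bracket Z W) Y)// (@BN (bracket Z W) Y')//; ring.
ring.
Qed.

Lemma real_extd3_smooth Y Z W : vfield Y -> vfield Z -> vfield W -> smooth (real_extd3 Y Z W).
Proof.
move=> Yf Zf Wf p; rewrite /real_extd3.
have SB U V : vfield U -> vfield V -> smooth_at (B U V) p by move=> ? ?; exact: smB.
have YZ := vbr Yf Zf; have YW := vbr Yf Wf; have ZW := vbr Zf Wf.
apply: (smooth_atB X_manifold); last exact: SB.
apply: (smooth_atD X_manifold); last exact: SB.
apply: (smooth_atB X_manifold); last exact: SB.
apply: (smooth_atD X_manifold); last exact/Wf.2/SB.
by apply: (smooth_atB X_manifold); [exact/Yf.2/SB|exact/Zf.2/SB].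
Qed.

Lemma derive_real_extd3 T Y Z W p : vfield T -> vfield Y -> vfield Z -> vfield W ->
  T p (real_extd3 Y Z W) =
  T p (fun q => Y q (B Z W)) - T p (fun q => Z q (B Y W)) + T p (fun q => W q (B Y Z))
  - T p (B (bracket Y Z) W) + T p (B (bracket Y W) Z) - T p (B (bracket Z W) Y).
Proof.
move=> Tf Yf Zf Wf; rewrite /real_extd3.
have alt (a b c d e f : X -> R) : smooth_at a p -> smooth_at b p -> smooth_at c p ->
    smooth_at d p -> smooth_at e p -> smooth_at f p ->
    T p (fun q => a q - b q + c q - d q + e q - f q) =
    T p a - T p b + T p c - T p d + T p e - T p f.
  move=> Sa Sb Sc Sd Se Sf; have Tp := Tf.1 p.
  have Sab := smooth_atB X_manifold Sa Sb.
  have Sabc := smooth_atD X_manifold Sab Sc.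
  have Sabcd := smooth_atB X_manifold Sabc Sd.
  have Sabcde := smooth_atD X_manifold Sabcd Se.
  rewrite (tangentB X_manifold Tp Sabcde Sf) (tangentD Tp Sabcd Se).
  by rewrite (tangentB X_manifold Tp Sabc Sd) (tangentD Tp Sab Sc) (tangentB X_manifold Tp Sa Sb).
have SB U V : vfield U -> vfield V -> smooth_at (B U V) p by move=> ? ?; exact: smB.
have YZ := vbr Yf Zf; have YW := vbr Yf Wf; have ZW := vbr Zf Wf.
by apply: alt; [exact/Yf.2/SB|exact/Zf.2/SB|exact/Wf.2/SB|exact: SB|exact: SB|exact: SB].
Qed.

Lemma two_form_jacobi Y Z W T p : vfield Y -> vfield Z -> vfield W -> vfield T ->
  B (bracket (bracket Y Z) W) T p = B (bracket (bracket Y W) Z) T p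
    - B (bracket (bracket Z W) Y) T p.
Proof.
move=> Yf Zf Wf Tf.
have J := congr1 (fun U => B U T p) (jacobi X_manifold Yf Zf Wf).
have YZ := vbr Yf Zf; have ZW := vbr Zf Wf; have WY := vbr Wf Yf; have YW := vbr Yf Wf.
have v1 := vbr YZ Wf; have v2 := vbr ZW Yf; have v3 := vbr WY Zf; have v4 := vbr YW Zf.
have v5 := vfield_comb X_manifold (@cst_smooth 1) v2 v3.
move: J; rewrite /= BL// BL// two_form0//.
have -> : bracket (bracket W Y) Z =
    vcomb (fun=> -1) (bracket (bracket Y W) Z) (@vzero R X).
  apply/funext => q; apply/funext => f; rewrite /vcomb /vzero.
  have [Sf|nSf] := pselect (smooth_at f q).
    by rewrite !(vfield_bracket2 X_manifold)//; ring.
  by rewrite !bracket_nonsmooth//; ring.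
rewrite BL//; last exact: vfield0 X_manifold.
by rewrite two_form0// => J; lra.
Qed.

(** The square of the exterior derivative is zero. Second derivatives of [B]
    cancel by the definition of the bracket, the values of [B] at two brackets
    by antisymmetry, and the values at iterated brackets by the Jacobi identity.
    *)
Lemma real_extd3_closed Y1 Y2 Y3 Y4 p : vfield Y1 -> vfield Y2 -> vfield Y3 -> vfield Y4 ->
  Y1 p (real_extd3 Y2 Y3 Y4) - Y2 p (real_extd3 Y1 Y3 Y4) + Y3 p (real_extd3 Y1 Y2 Y4)
  - Y4 p (real_extd3 Y1 Y2 Y3)
  - real_extd3 (bracket Y1 Y2) Y3 Y4 p + real_extd3 (bracket Y1 Y3) Y2 Y4 p
  - real_extd3 (bracket Y1 Y4) Y2 Y3 p - real_extd3 (bracket Y2 Y3) Y1 Y4 p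
  + real_extd3 (bracket Y2 Y4) Y1 Y3 p - real_extd3 (bracket Y3 Y4) Y1 Y2 p = 0.
Proof.
move=> f1 f2 f3 f4; rewrite !derive_real_extd3// /real_extd3.
rewrite !(bracketE _ _ (smB _ _ _))//.
rewrite (two_form_jacobi p f1 f2 f3 f4) (two_form_jacobi p f1 f2 f4 f3).
rewrite (two_form_jacobi p f1 f3 f4 f2) (two_form_jacobi p f2 f3 f4 f1).
rewrite (BN p (vbr f3 f4) (vbr f1 f2)) (BN p (vbr f2 f4) (vbr f1 f3)).
rewrite (BN p (vbr f2 f3) (vbr f1 f4)).
ring.
Qed.

End RealTwoForms.

(** * The exterior derivative of a vector-valued 2-form *)

Section ExteriorDerivative.
Context {R : realType} {M : smooth_space R} {V : lmodType R}.
Implicit Types (w : seq (vect M) -> M -> V) (X Y Z T : vect M) (p : M).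

Let sum_gt k i (F : 'I_k -> V) :
  \sum_(j < k | (i < j)%N) F j = \sum_(j < k) if (i < j)%N then F j else 0.
Proof. exact: big_mkcond. Qed.

Lemma extd2E w X Y p : extd w [:: X; Y] p =
  vder X (w [:: Y]) p - vder Y (w [:: X]) p - w [:: bracket X Y] p.
Proof.
rewrite /extd /= !big_ord_recl !big_ord0 !sum_gt !big_ord_recl !big_ord0 /=.
rewrite /del /bump /= !(add0n, add1n, addn0, addSn) /=.
rewrite !(exprS, expr0, mulr1, mulN1r, opprK, scale1r, scaleN1r).
by rewrite !(add0r, addr0, addrA).
Qed.

Lemma extd3E w X Y Z p : extd w [:: X; Y; Z] p =
  vder X (w [:: Y; Z]) p - vder Y (w [:: X; Z]) p + vder Z (w [:: X; Y]) p
  - w [:: bracket X Y; Z] p + w [:: bracket X Z; Y] p - w [:: bracket Y Z; X] p.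
Proof.
rewrite /extd /= !big_ord_recl !big_ord0 !sum_gt !big_ord_recl !big_ord0 /=.
rewrite /del /bump /= !(add0n, add1n, addn0, addSn) /=.
rewrite !(exprS, expr0, mulr1, mulN1r, opprK, scale1r, scaleN1r).
by rewrite !(add0r, addr0, addrA).
Qed.

Lemma extd4E w X Y Z T p : extd w [:: X; Y; Z; T] p =
  vder X (w [:: Y; Z; T]) p - vder Y (w [:: X; Z; T]) p + vder Z (w [:: X; Y; T]) p
  - vder T (w [:: X; Y; Z]) p
  - w [:: bracket X Y; Z; T] p + w [:: bracket X Z; Y; T] p
  - w [:: bracket X T; Y; Z] p - w [:: bracket Y Z; X; T] p
  + w [:: bracket Y T; X; Z] p - w [:: bracket Z T; X; Y] p.
Proof.
rewrite /extd /= !big_ord_recl !big_ord0 !sum_gt !big_ord_recl !big_ord0 /=.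
rewrite /del /bump /= !(add0n, add1n, addn0, addSn) /=.
rewrite !(exprS, expr0, mulr1, mulN1r, opprK, scale1r, scaleN1r).
by rewrite !(add0r, addr0, addrA).
Qed.
End ExteriorDerivative.

Section VFields.
Context {R : realType} {M : smooth_space R}.

Lemma vfields_cons k (X : vect M) s :
  vfields k.+1 (X :: s) <-> vfield X /\ vfields k s.
Proof.
split=> [[[sk] H]|[Xf [sk H]]].
  by split; [exact: (H 0%N)|split=> // i ik; exact: (H i.+1)].
by split=> [/=|[|i] ik //=]; [rewrite sk|exact: H].
Qed.

Lemma vfields_nil k : vfields k ([::] : seq (vect M)) <-> k = 0%N.
Proof. by split=> [[]//|->]; split. Qed.

Lemma vfields1 (X : vect M) : vfield X -> vfields 1 [:: X].
Proof. by move=> Xf; apply/vfields_cons; split => //; exact/vfields_nil. Qed.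

Lemma vfields2 (X Y : vect M) : vfield X -> vfield Y -> vfields 2 [:: X; Y].
Proof. by move=> Xf Yf; apply/vfields_cons; split => //; exact: vfields1. Qed.

End VFields.

Section OneForm.
Context {R : realType} {m : nat} {M : smooth_space R} {V : lmodType R}.
Hypothesis M_manifold : is_manifold m M.
Variable w : seq (vect M) -> M -> V.
Hypothesis w_form : form 1 w.

Lemma one_formD X Y p : vfield X -> vfield Y ->
  w [:: vcomb (fun=> 1) X Y] p = w [:: X] p + w [:: Y] p.
Proof.
move=> Xf Yf; have [_ wL _] := w_form.
rewrite (wL [::] [::] X Y _ (smooth_cst M_manifold 1) (vfields1 Xf) (vfields1 Yf)).
by rewrite scale1r.
Qed.

Lemma one_form0 p : w [:: @vzero R M] p = 0.
Proof.
have V0 := vfield0 M_manifold; have := one_formD p V0 V0.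
rewrite (_ : vcomb _ _ _ = @vzero R M).
  by move=> /eqP; rewrite addrC -subr_eq subrr => /eqP <-.
by apply/funext => q; apply/funext => f; rewrite /vcomb /vzero; ring.
Qed.

End OneForm.

Section ExtdTwoForm.
Context {R : realType} {m : nat} {M : smooth_space R} {V : lmodType R}.
Hypothesis M_manifold : is_manifold m M.
Hypothesis V_coords : finite_coords V.
Variable b : seq (vect M) -> M -> V.
Hypothesis b_form : form 2 b.
Implicit Types (X Y Z W : vect M).

Let scomb (l : {linear V -> R^o}) Y Z q : R := l (b [:: Y; Z] q).

(** The form vanishes on the pair ([Y + Z], [Y + Z]), whose expansion is the sum of
    the two sides and of two more terms that vanish for the same reason. *)
Lemma two_formN Y Z p : vfield Y -> vfield Z -> b [:: Y; Z] p = - b [:: Z; Y] p.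
Proof.
move=> Yf Zf; have [_ bL b0] := b_form.
have S1 := smooth_cst M_manifold 1.
pose U := vcomb (fun=> 1 : R) Y Z.
have Uf : vfield U by exact: (vfield_comb M_manifold).
have alt W : vfield W -> b [:: W; W] = (fun=> 0).
  by move=> Wf; apply: (b0 [::] [::] [::] W); exact: vfields2.
have := congr1 (fun f => f p) (alt _ Uf).
rewrite (bL [::] [:: U] Y Z _ S1 (vfields2 Yf Uf) (vfields2 Zf Uf)).
rewrite (bL [:: Y] [::] Y Z _ S1 (vfields2 Yf Yf) (vfields2 Yf Zf)).
rewrite (bL [:: Z] [::] Y Z _ S1 (vfields2 Zf Yf) (vfields2 Zf Zf)).
by rewrite !alt// !scale1r add0r addr0 => /eqP; rewrite addr_eq0 => /eqP.
Qed.

Let scomb_form l : real_two_form (scomb l).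
Proof.
have [bs bL b0] := b_form; split=> [Y Z Yf Zf|h Y Z W p Sh Yf Zf Wf|Y Z p Yf Zf].
- exact: (bs _ (vfields2 Yf Zf)).
- rewrite /scomb (bL [::] [:: W] Y Z _ Sh (vfields2 Yf Wf) (vfields2 Zf Wf)).
  by rewrite linearP.
- by rewrite /scomb two_formN// linearN.
Qed.

(** Linear forms separate the values and commute with the exterior derivative,
    which reduces all the properties of [extd b] to those of [real_extd3]. *)
Lemma linear_form_extd3 (l : {linear V -> R^o}) X Y Z p :
  vfield X -> vfield Y -> vfield Z ->
  l (extd b [:: X; Y; Z] p) = real_extd3 (fun Y Z q => l (b [:: Y; Z] q)) X Y Z p.
Proof.
move=> Xf Yf Zf; have [bs _ _] := b_form.
have der T U W : vfield T -> vfield U -> vfield W ->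
    l (vder T (b [:: U; W]) p) = T p (fun q => l (b [:: U; W] q)).
  move=> Tf Uf Wf; rewrite (vder_linear_form M_manifold)//; first exact: Tf.1.
  by move=> k; exact: (bs _ (vfields2 Uf Wf)).
by rewrite extd3E !(linearB, linearD) /= !der.
Qed.

Lemma extd3_swap12 X Y Z p : vfield X -> vfield Y -> vfield Z ->
  extd b [:: X; Y; Z] p = - extd b [:: Y; X; Z] p.
Proof.
move=> Xf Yf Zf; apply: coords_separate => // l.
rewrite linearN !linear_form_extd3//.
exact: (real_extd3_swap12 M_manifold (scomb_form l)).
Qed.

Lemma extd3_swap23 X Y Z p : vfield X -> vfield Y -> vfield Z ->
  extd b [:: X; Y; Z] p = - extd b [:: X; Z; Y] p.
Proof.
move=> Xf Yf Zf; apply: coords_separate => // l.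
rewrite linearN !linear_form_extd3//.
exact: (real_extd3_swap23 M_manifold (scomb_form l)).
Qed.

Lemma extd3_comb (h : M -> R) X X' Y Z p :
  smooth h -> vfield X -> vfield X' -> vfield Y -> vfield Z ->
  extd b [:: vcomb h X X'; Y; Z] p =
  h p *: extd b [:: X; Y; Z] p + extd b [:: X'; Y; Z] p.
Proof.
move=> Sh Xf X'f Yf Zf; apply: coords_separate => // l.
have Cf := vfield_comb M_manifold Sh Xf X'f.
rewrite linearP !linear_form_extd3//.
exact: (real_extd3_comb M_manifold (scomb_form l)).
Qed.

Lemma smooth_extd3 X Y Z : vfield X -> vfield Y -> vfield Z ->
  smooth_vec (extd b [:: X; Y; Z]).
Proof.
move=> Xf Yf Zf l.
rewrite (_ : l \o _ = real_extd3 (fun Y Z q => l (b [:: Y; Z] q)) X Y Z).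
  exact: (real_extd3_smooth M_manifold (scomb_form l)).
by apply/funext => p; exact: linear_form_extd3.
Qed.

(** The cyclic shape in which [dS] is written. *)
Lemma extd3_cyclic X Y Z p : vfield X -> vfield Y -> vfield Z ->
  extd b [:: X; Y; Z] p =
    (vder X (b [:: Y; Z]) p - b [:: bracket X Y; Z] p)
  + (vder Y (b [:: Z; X]) p - b [:: bracket Y Z; X] p)
  + (vder Z (b [:: X; Y]) p - b [:: bracket Z X; Y] p).
Proof.
move=> Xf Yf Zf; have [bs _ _] := b_form; rewrite extd3E.
have -> : b [:: bracket X Z; Y] p = - b [:: bracket Z X; Y] p.
  apply: coords_separate => // l; rewrite linearN.
  exact: (two_form_bracketN M_manifold (scomb_form l)).
have -> : vder Y (b [:: X; Z]) p = - vder Y (b [:: Z; X]) p.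
  rewrite [RHS](linear_vder M_manifold (-%R : {linear _ -> _}) V_coords V_coords (Yf.1 p)).
    by congr (vder _ _ p); apply/funext => q; exact: two_formN.
  exact: (bs _ (vfields2 Zf Xf)).
rewrite opprK; apply: coords_separate => // l.
rewrite !(linearB, linearD); ring.
Qed.

Let self_opp (v : V) : v = - v -> v = 0.
Proof.
move=> vN; have : (2 : R) *: v = 0 by rewrite scaler_nat mulr2n {2}vN subrr.
by move/eqP; rewrite scaler_eq0 pnatr_eq0 /= => /eqP.
Qed.

(** The swaps bring any slot to the first one, where [extd3_comb] applies, and
    force a repeated argument to give a value equal to its opposite. *)
Lemma form_extd3 : form 3 (extd b).
Proof.
split.
- case=> [|X [|Y [|Z [|? ?]]]] [] //= _ H.
  by apply: smooth_extd3; [exact: (H 0%N)|exact: (H 1%N)|exact: (H 2)].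
- case=> [|A [|A' [|? ?]]] [|B [|B' [|? ?]]] X Y h Sh [+ HX] [_ HY];
    rewrite /= ?size_cat /= ?addnS //= => _; apply/funext => p.
  + have Xf := HX 0%N isT; have Yf := HY 0%N isT.
    exact: extd3_comb (HX 1%N isT) (HX 2 isT).
  + have Xf := HX 1%N isT; have Yf := HY 1%N isT.
    have Af := HX 0%N isT; have Bf := HX 2 isT.
    have Cf := vfield_comb M_manifold Sh Xf Yf.
    rewrite (extd3_swap12 p Af Cf Bf) (extd3_swap12 p Af Xf Bf) (extd3_swap12 p Af Yf Bf).
    by rewrite extd3_comb// opprD scalerN.
  + have Xf := HX 2 isT; have Yf := HY 2 isT.
    have Af := HX 0%N isT; have Bf := HX 1%N isT.
    have Cf := vfield_comb M_manifold Sh Xf Yf.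
    have turn Z : vfield Z -> extd b [:: A; A'; Z] p = extd b [:: Z; A; A'] p.
      by move=> Zf; rewrite extd3_swap23// extd3_swap12// opprK.
    by rewrite !turn// extd3_comb.
- case=> [|A [|? ?]] [|B [|? ?]] [|D [|? ?]] X [+ H];
    rewrite /= ?size_cat /= ?size_cat /= ?addnS //= => _; apply/funext => p;
    apply: self_opp.
  + exact: extd3_swap12 (H 0%N isT) (H 0%N isT) (H 2 isT).
  + have Xf := H 0%N isT; have Bf := H 1%N isT.
    by rewrite {1}extd3_swap12// extd3_swap23// opprK extd3_swap12.
  + exact: extd3_swap23 (H 0%N isT) (H 1%N isT) (H 1%N isT).
Qed.

Lemma closed_extd3 : closed_form 3 (extd b).
Proof.
split; first exact: form_extd3.
case=> [|X1 [|X2 [|X3 [|X4 [|? ?]]]]] [] //= _ H; apply/funext => p.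
have f1 : vfield X1 := H 0%N isT; have f2 : vfield X2 := H 1%N isT.
have f3 : vfield X3 := H 2 isT; have f4 : vfield X4 := H 3 isT.
have br X Y : vfield X -> vfield Y -> vfield (bracket X Y).
  by move=> Xf Yf; exact: (vfield_bracket M_manifold Xf Yf).
apply: coords_separate => // l; rewrite linear0 extd4E.
have der T X Y Z : vfield T -> vfield X -> vfield Y -> vfield Z ->
    l (vder T (extd b [:: X; Y; Z]) p) =
    T p (real_extd3 (fun Y Z q => l (b [:: Y; Z] q)) X Y Z).
  move=> Tf Xf Yf Zf; rewrite (vder_linear_form M_manifold)//.
  - by congr (T p _); apply/funext => q; exact: linear_form_extd3.
  - exact: Tf.1.
  - by move=> k; exact: smooth_extd3.
have f12 := br _ _ f1 f2; have f13 := br _ _ f1 f3; have f14 := br _ _ f1 f4.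
have f23 := br _ _ f2 f3; have f24 := br _ _ f2 f4; have f34 := br _ _ f3 f4.
have linear10 (a1 a2 a3 a4 a5 a6 a7 a8 a9 a10 : V) :
    l (a1 - a2 + a3 - a4 - a5 + a6 - a7 - a8 + a9 - a10) =
    l a1 - l a2 + l a3 - l a4 - l a5 + l a6 - l a7 - l a8 + l a9 - l a10.
  by rewrite !(linearB, linearD).
rewrite linear10 !der// !linear_form_extd3//.
exact: (real_extd3_closed M_manifold (scomb_form l)).
Qed.

End ExtdTwoForm.

(** * Passing between the base and the total space *)

Section Related.
Context {R : realType} {m d : nat} {M P : smooth_space R}.
Hypothesis M_manifold : is_manifold m M.
Hypothesis P_manifold : is_manifold d P.
Variable pr : P -> M.
Hypothesis pr_smooth : smooth_map pr.

(** Near [p], the function [Y (f o pr)] is the pullback of [y f], to which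
    relatedness of [X] and [x] applies. *)
Lemma related_bracket (X Y : vect P) (x y : vect M) :
  vfield X -> vfield Y -> vfield x -> vfield y ->
  related pr X x -> related pr Y y -> related pr (bracket X Y) (bracket x y).
Proof.
move=> Xf Yf xf yf Xx Yy p f Sf; have Spf := (pr_smooth p).2 f Sf.
rewrite bracketE// bracketE//.
have near_rel Z z : related pr Z z ->
    \forall q \near p, Z q (f \o pr) = z (pr q) f.
  move=> Zz; have : nbhs p [set q | smooth_at f (pr q)].
    by apply: (pr_smooth p).1; exact: (smooth_at_near M_manifold Sf).
  by apply: filterS => q /= Sq; exact: Zz.
rewrite (tangent_eq P_manifold (Xf.1 p) (near_rel _ _ Yy)); last exact: Yf.2.
rewrite (tangent_eq P_manifold (Yf.1 p) (near_rel _ _ Xx)); last exact: Xf.2.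
congr (_ - _); first by apply: (Xx p (fun r => y r f)); exact: yf.2.
by apply: (Yy p (fun r => x r f)); exact: xf.2.
Qed.

Lemma related_vder (V : lmodType R) (X : vect P) (x : vect M) (f : M -> V) p :
  finite_coords V -> vfield X -> vfield x -> related pr X x -> smooth_vec f ->
  vder X (f \o pr) p = vder x f (pr p).
Proof.
move=> Vc Xf xf Xx Sf; apply: coords_separate => // l.
rewrite (vder_linear_form P_manifold)//; [|exact: Xf.1|]; last first.
  by move=> k; exact: ((pr_smooth p).2 (k \o f) (Sf k _)).
rewrite (vder_linear_form M_manifold)//; [|exact: xf.1|by move=> k; exact: Sf].
exact: (Xx p (l \o f) (Sf l _)).
Qed.

End Related.

Section Bundle.
Context {R : realType} {n m d : nat} {M P : smooth_space R}.
Hypothesis M_manifold : is_manifold m M.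
Hypothesis P_manifold : is_manifold d P.
Context {pr : P -> M} {act : P -> PU R n -> P}.
Hypothesis P_bundle : principal_bundle pr act.

(** A trivialization carries the fibre to the group, where [(tau p)^-1 * tau q]
    moves [tau p] to [tau q]. *)
Lemma fibre_transitive p q : pr p = pr q -> exists k, q = act p k.
Proof.
case: P_bundle => _ _ _ pr_act triv pq.
have [U [tau [psi [[_ Up] [psiK _ tau_act]]]]] := triv (pr p).
exists ((tau p)^-1 * tau q)%g; set r := act p _.
have prr : pr r = pr q by rewrite pr_act.
have Uq : U (pr q) by rewrite -pq.
rewrite -(psiK q Uq).1 -(psiK r _).1 ?prr//; congr (psi (_, _)).
by rewrite tau_act// mulgA mulgV mul1g.
Qed.

Lemma bundle_surjective x : exists p, pr p = x.
Proof.
case: P_bundle => _ _ _ _ triv.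
have [U [tau [psi [[_ Ux] [_ psiE _]]]]] := triv x.
by exists (psi (x, 1%g)); case: (psiE x 1%g Ux).
Qed.

(** Composing with a local section [y |-> psi (y, 1)] recovers [g] from its
    pullback. By the definition of smoothness on a product, the pullback is near
    [(x, 1)] a smooth function [F] of smooth functions of the two factors, and
    freezing the second factor leaves a smooth function on the base. *)
Lemma smooth_descends (g : M -> R) : smooth (g \o pr) -> smooth g.
Proof.
move=> Sg x; case: P_bundle => _ _ _ _ triv.
have [U [tau [psi [Ux [_ psiE _]]]]] := triv x.
have [_ _ [_ psi_smooth]] := psiE x 1%g Ux.2.
have [a [b [gs [hs [F]]]]] := psi_smooth (g \o pr) (Sg _).
move=> /= [Sgs _ CF gF].
pose G (y : M) := row_mx (\row_i gs i y) (\row_j hs j 1%g).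
apply: (@smooth_at_eq _ _ _ M_manifold (fun y => F (G y))); last first.
  apply: (smooth_at_comp M_manifold) => // j.
  case: (split_ordP j) => i ->.
    rewrite (_ : (fun _ => _) = gs i); first exact: Sgs.
    by apply/funext => y; rewrite row_mxEl mxE.
  rewrite (_ : (fun _ => _) = (fun=> hs i 1%g)); first exact: (smooth_at_cst M_manifold).
  by apply/funext => y; rewrite row_mxEr mxE.
case: gF => -[A1 A2] /= [xA1 oneA2] gF.
apply: filterS2 (open_nbhs_nbhs Ux) xA1 => y Uy A1y.
have /= <- := gF (y, 1%g) (conj A1y (nbhs_singleton oneA2)).
by case: (psiE y 1%g Uy) => ->.
Qed.

End Bundle.

(** * The Bianchi identity and the vanishing of the class *)

Section Bianchi.
Context {R : realType} {n m d : nat} {M P : smooth_space R}.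
Hypothesis n_gt0 : (0 < n)%N.
Hypothesis M_manifold : is_manifold m M.
Hypothesis P_manifold : is_manifold d P.
Context {pr : P -> M} {act : P -> PU R n -> P}.
Hypothesis pr_smooth : smooth_map pr.
Context {theta : seq (vect P) -> P -> pu_alg R n}.
Hypothesis theta_form : form 1 theta.
Context {sigma : vect M -> vect P}.
Hypothesis sigma_lift : horizontal_lift pr act theta sigma.
Context {Omega : seq (vect M) -> P -> u_alg R n}.
Hypothesis Omega_lift : curvature_lift pr act theta Omega.
Implicit Types (x y z : vect M) (X Y : vect P) (p : P).

Let pu_coords := pu_alg_coords (R := R) n_gt0.

Let lift_field x : vfield x -> vfield (sigma x).
Proof. by move=> /sigma_lift[[]]. Qed.

Let lift_related x : vfield x -> related pr (sigma x) x.
Proof. by move=> /sigma_lift[]. Qed.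

Let theta_lift x : vfield x -> theta [:: sigma x] = (fun=> 0).
Proof. by move=> /sigma_lift[]. Qed.

(** A horizontal lift is annihilated by [theta], so the bracket term of the
    curvature and one of the two derivatives vanish. *)
Lemma curvature_horizontal X y p : vfield X -> vfield y ->
  curvature theta X (sigma y) p =
  - vder (sigma y) (theta [:: X]) p - theta [:: bracket X (sigma y)] p.
Proof.
move=> Xf yf; rewrite /curvature extd2E theta_lift//.
rewrite (vder0 P_manifold pu_coords); last exact: Xf.1.
have br0 a : pu_bracket a (0 : pu_alg R n) = 0.
  rewrite -(to_pu_repr a) -(linear0 (@to_pu R n)) pu_bracketE; congr to_pu.
  by apply: val_inj; rewrite /= mulmx0 mul0mx subrr.
have br0l a : pu_bracket (0 : pu_alg R n) a = 0.
  rewrite -(to_pu_repr a) -(linear0 (@to_pu R n)) pu_bracketE; congr to_pu.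
  by apply: val_inj; rewrite /= mulmx0 mul0mx subrr.
by rewrite br0 br0l subrr scaler0 addr0 sub0r.
Qed.

(** In pu_n the form Omega becomes the curvature. Let Xi be the horizontal lift
    of xi. By [curvature_horizontal], the derivative of Omega(x2, x3) along x1
    contributes the derivative of - theta([X2, X3]) along X1. The horizontal
    lift of [x1, x2] is in general not [X1, X2], but the curvature may be
    evaluated on any related fields; on [X1, X2] and X3 it is - X3(theta([X1,
    X2])) - theta([[X1, X2], X3]). The derivatives cancel in the cyclic sum and
    the rest is the value of theta on the Jacobi sum. *)
Lemma bianchi x1 x2 x3 p : vfield x1 -> vfield x2 -> vfield x3 ->
  to_pu (dS sigma Omega x1 x2 x3 p) = 0.
Proof.
move=> f1 f2 f3; have [[Os _ _] Oc] := Omega_lift; have [ts _ _] := theta_form.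
have brP X Y : vfield X -> vfield Y -> vfield (bracket X Y).
  by move=> Xf Yf; exact: (vfield_bracket P_manifold Xf Yf).
have brM x y : vfield x -> vfield y -> vfield (bracket x y).
  by move=> xf yf; exact: (vfield_bracket M_manifold xf yf).
have Olift x y q : vfield x -> vfield y ->
    to_pu (Omega [:: x; y] q) = - theta [:: bracket (sigma x) (sigma y)] q.
  move=> xf yf; have sx := lift_field xf; have sy := lift_field yf.
  rewrite (Oc x y (sigma x) (sigma y))//; [|exact: lift_related|exact: lift_related].
  rewrite curvature_horizontal// theta_lift// (vder0 P_manifold pu_coords).
    by rewrite oppr0 sub0r.
  exact: sy.1.
have Sterm x y z : vfield x -> vfield y -> vfield z ->
    to_pu (vder (sigma x) (Omega [:: y; z]) p) =
    - vder (sigma x) (theta [:: bracket (sigma y) (sigma z)]) p.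
  move=> xf yf zf; have sx := lift_field xf.
  have sy := lift_field yf; have sz := lift_field zf.
  rewrite (linear_vder P_manifold _ (u_alg_coords n) pu_coords (sx.1 p)); last first.
    by have [] := Os _ (vfields2 yf zf).
  rewrite [RHS](linear_vder P_manifold (-%R : {linear _ -> _}) pu_coords pu_coords (sx.1 p)).
    by congr (vder _ _ p); apply/funext => q; exact: Olift.
  exact: (ts _ (vfields1 (brP _ _ sy sz))).
have Bterm x y z : vfield x -> vfield y -> vfield z ->
    to_pu (Omega [:: bracket x y; z] p) =
    - vder (sigma z) (theta [:: bracket (sigma x) (sigma y)]) p
    - theta [:: bracket (bracket (sigma x) (sigma y)) (sigma z)] p.
  move=> xf yf zf; have sx := lift_field xf.
  have sy := lift_field yf; have sz := lift_field zf.
  rewrite (Oc _ z (bracket (sigma x) (sigma y)) (sigma z)) ?curvature_horizontal//.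
  - exact: brP.
  - exact: brM.
  - exact: brP.
  - by apply: (related_bracket M_manifold P_manifold pr_smooth) => //; exact: lift_related.
  - exact: lift_related.
have s1 := lift_field f1; have s2 := lift_field f2; have s3 := lift_field f3.
have := congr1 (fun X => theta [:: X] p) (jacobi P_manifold s1 s2 s3).
have b12 := brP _ _ s1 s2; have b23 := brP _ _ s2 s3; have b31 := brP _ _ s3 s1.
have c1 := brP _ _ b12 s3; have c2 := brP _ _ b23 s1; have c3 := brP _ _ b31 s2.
have c23 := vfield_comb P_manifold (smooth_cst P_manifold 1) c2 c3.
rewrite /= !(one_formD P_manifold theta_form)// (one_form0 P_manifold theta_form) => J.
rewrite /dS !(linearB, linearD) /= !Sterm// !Bterm//.
rewrite -[RHS]J.
set v1 := vder (sigma x1) _ p; set v2 := vder (sigma x2) _ p; set v3 := vder (sigma x3) _ p.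
rewrite !opprD !opprK ![- _ + (_ + _)]addrA ![- _ + _]addrC.
by rewrite [X in X + _]addrACA subrKA addrACA subrKA subrr add0r addrA.
Qed.

End Bianchi.

Theorem corollary2 (R : realType) (n : nat) (n_ge1 : (1 <= n)%N)
  (m d : nat) (M P : smooth_space R)
  (M_manifold : is_manifold m M)
  (M_connected : connected [set: M])
  (M_deRham : finite_dim_deRham M)
  (P_manifold : is_manifold d P)
  (pr : P -> M) (act : P -> PU R n -> P)
  (P_bundle : principal_bundle pr act)
  (theta : seq (vect P) -> P -> pu_alg R n)
  (theta_connection : connection act theta)
  (sigma : vect M -> vect P)
  (sigma_lift : horizontal_lift pr act theta sigma)
  (Omega : seq (vect M) -> P -> u_alg R n)
  (Omega_lift : curvature_lift pr act theta Omega) :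
  exists2 omega : seq (vect M) -> M -> u_alg R 1,
    is_omega_topalg pr sigma Omega omega & exact_form 3 omega.
Proof.
have pr_smooth : smooth_map pr by case: P_bundle.
have theta_form : form 1 theta by case: theta_connection.
have [[Os OL O0] _] := Omega_lift.
(* A set-theoretic section suffices: the trace of Omega is constant on the
   fibres because the trace is invariant under the adjoint action. *)
have [sec secK] := choice (bundle_surjective P_bundle).
pose beta s x := u_trace (Omega s (sec x)).
have betaE s p : vfields 2 s -> u_trace (Omega s p) = beta s (pr p).
  move=> /Os[_ Oequi]; rewrite /beta; have [k ->] := fibre_transitive P_bundle (esym (secK (pr p))).
  by rewrite Oequi u_trace_Ad.
have beta_smooth s : vfields 2 s -> smooth_vec (beta s).
  move=> sf l; apply: (smooth_descends M_manifold P_bundle).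
  rewrite (_ : _ \o _ = (l \o u_trace (n := n) : {linear _ -> _}) \o Omega s).
    by have [Ss _] := Os s sf; exact: Ss.
  by apply/funext => p; rewrite /= betaE.
have beta_form : form 2 beta.
  split=> [//|s t X Y f Sf HX HY|s t u X HX]; apply/funext => x; rewrite /beta.
    by rewrite (OL s t X Y f Sf HX HY) linearP secK.
  by rewrite (O0 s t u X HX) linear0.
exists (extd beta); last by exists beta.
split; first exact: closed_extd3 M_manifold (u_alg_coords 1) _ beta_form.
move=> x1 x2 x3 f1 f2 f3 p.
have dS0 := bianchi n_ge1 M_manifold P_manifold pr_smooth theta_form sigma_lift
  Omega_lift p f1 f2 f3.
(* d_S Omega is scalar by the Bianchi identity, so it is enough to compare
   normalized traces; the trace commutes with all the derivatives. *)
rewrite (to_pu_eq0 n_ge1 dS0); congr u_scalar.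
have brM (x y : vect M) : vfield x -> vfield y -> vfield (bracket x y).
  by move=> xf yf; exact: (vfield_bracket M_manifold xf yf).
have der (x y z : vect M) : vfield x -> vfield y -> vfield z ->
    u_trace (vder (sigma x) (Omega [:: y; z]) p) = vder x (beta [:: y; z]) (pr p).
  move=> xf yf zf; have [[sf _] sx _] := sigma_lift x xf.
  have yzf := vfields2 yf zf.
  rewrite (linear_vder P_manifold _ (u_alg_coords n) (u_alg_coords 1) (sf.1 p)).
    rewrite -(related_vder M_manifold P_manifold pr_smooth p (u_alg_coords 1) sf xf sx).
      by congr (vder _ _ p); apply/funext => q; exact: betaE.
    exact: beta_smooth.
  by have [] := Os _ yzf.
have b12 := brM _ _ f1 f2; have b23 := brM _ _ f2 f3; have b31 := brM _ _ f3 f1.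
rewrite (extd3_cyclic M_manifold (u_alg_coords 1) beta_form)// -!der//.
rewrite -!betaE; [|exact: vfields2..].
by rewrite /dS !(linearB, linearD).
Qed.
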